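(* There is an algorithm that, given a graph $G$ with $n$ nodes and $m$ edges, decides in time $\mathcal O(nm)$ whether $G$ contains a propeller as a subgraph (outputting YES if $G$ contains no propeller as a subgraph, and NO otherwise).
   Context: All graphs are finite, simple and undirected. A propeller $(C,x)$ is a graph consisting of a chordless cycle $C$ (the rim) and a node $x\notin V(C)$ (the center) that has at least two neighbors on $C$. $G$ contains $F$ as a subgraph if $F$ is isomorphic to a subgraph of $G$. *)

(* Defs.v *)
From mathcomp Require Import all_boot.
Set Implicit Arguments.
Unset Strict Implicit.
Unset Printing Implicit Defensive.

(** * Graphs *)

Record sgraph := SGraph {
  vertex :> finType;
  edge : rel vertex;
  edge_sym : symmetric edge;
  edge_irr : irreflexive edge
}.

Definition edge_set (G : sgraph) : {set {set G}} :=
  [set [set p.1; p.2] | p : G * G & edge p.1 p.2].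

Definition num_nodes (G : sgraph) : nat := #|G|.
Definition num_edges (G : sgraph) : nat := #|edge_set G|.

(** A subgraph (not necessarily induced): some of the nodes, and some of the
    edges of [G] joining them. *)
Record subgraph (G : sgraph) := Subgraph {
  sub_nodes : {set G};
  sub_edge : rel G;
  sub_edgeP : forall x y, sub_edge x y ->
    [&& x \in sub_nodes, y \in sub_nodes & edge x y];
  sub_edge_sym : symmetric sub_edge
}.

Section GraphOfSubgraph.
Variables (G : sgraph) (H : subgraph G).

Definition restricted_edge : rel {x : G | x \in sub_nodes H} :=
  fun x y => sub_edge H (val x) (val y).

Lemma restricted_edge_sym : symmetric restricted_edge.
Proof. by move=> x y; apply: sub_edge_sym. Qed.

Lemma restricted_edge_irr : irreflexive restricted_edge.
Proof.
by move=> x; apply/negP => /sub_edgeP /and3P[_ _]; rewrite edge_irr.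
Qed.

Definition graph_of_subgraph : sgraph :=
  SGraph restricted_edge_sym restricted_edge_irr.
End GraphOfSubgraph.

Definition isomorphic (F G : sgraph) : Prop :=
  exists f : F -> G, bijective f /\ forall x y, edge (f x) (f y) = edge x y.

Definition contains_as_subgraph (G F : sgraph) : Prop :=
  exists H : subgraph G, isomorphic F (graph_of_subgraph H).

(** The cycle is given by its nodes in cyclic order. *)
Definition chordless_cycle (G : sgraph) (C : seq G) : Prop :=
  [/\ 3 <= size C, uniq C, cycle (@edge G) C
    & {in C &, forall u v, edge u v -> v = next C u \/ u = next C v}].

Definition propeller_with (F : sgraph) (C : seq F) (x : F) : Prop :=
  [/\ chordless_cycle C, x \notin C,
      (forall y, y = x \/ y \in C)
    & 2 <= #|[set y in C | edge x y]|].

Definition propeller (F : sgraph) : Prop :=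
  exists (C : seq F) (x : F), propeller_with C x.

Definition contains_propeller (G : sgraph) : Prop :=
  exists F : sgraph, propeller F /\ contains_as_subgraph G F.

(** * Random access machines

    Uniform-cost RAM programs in structured form, over natural numbers: finitely
    many registers are mentioned by a program, and memory cells are addressed
    indirectly.  The only arithmetic is addition and truncated subtraction.
    Every constant, register access, memory access, arithmetic operation,
    comparison and branching costs one unit of time. *)

Inductive expr :=
| Const (k : nat)
| Reg (r : nat)
| Read (a : expr)
| Add (e1 e2 : expr)
| Sub (e1 e2 : expr).

Inductive test :=
| Lt (e1 e2 : expr)
| Eq (e1 e2 : expr).

Inductive prog :=
| Skip
| Assign (r : nat) (e : expr)
| Write (a e : expr)
| Seq (p q : prog)
| If (b : test) (p q : prog)
| While (b : test) (p : prog).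

Record state := State { reg : nat -> nat; mem : nat -> nat }.

Definition update (f : nat -> nat) (i v : nat) : nat -> nat :=
  fun j => if j == i then v else f j.

Fixpoint eval (s : state) (e : expr) : nat :=
  match e with
  | Const k => k
  | Reg r => reg s r
  | Read a => mem s (eval s a)
  | Add e1 e2 => eval s e1 + eval s e2
  | Sub e1 e2 => eval s e1 - eval s e2
  end.

Fixpoint expr_cost (e : expr) : nat :=
  match e with
  | Const _ | Reg _ => 1
  | Read a => (expr_cost a).+1
  | Add e1 e2 | Sub e1 e2 => (expr_cost e1 + expr_cost e2).+1
  end.

Definition eval_test (s : state) (b : test) : bool :=
  match b with
  | Lt e1 e2 => eval s e1 < eval s e2
  | Eq e1 e2 => eval s e1 == eval s e2
  end.

Definition test_cost (b : test) : nat :=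
  match b with
  | Lt e1 e2 | Eq e1 e2 => (expr_cost e1 + expr_cost e2).+1
  end.

(** [exec p s t s']: started in [s], the program [p] halts in [s'] after time
    exactly [t]. *)
Inductive exec : prog -> state -> nat -> state -> Prop :=
| ExecSkip s : exec Skip s 1 s
| ExecAssign s r e :
    exec (Assign r e) s (expr_cost e).+1
      (State (update (reg s) r (eval s e)) (mem s))
| ExecWrite s a e :
    exec (Write a e) s (expr_cost a + expr_cost e).+1
      (State (reg s) (update (mem s) (eval s a) (eval s e)))
| ExecSeq p q s t s1 t' s2 :
    exec p s t s1 -> exec q s1 t' s2 -> exec (Seq p q) s (t + t') s2
| ExecIfTrue b p q s t s' :
    eval_test s b -> exec p s t s' ->
    exec (If b p q) s (test_cost b + t).+1 s'
| ExecIfFalse b p q s t s' :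
    ~~ eval_test s b -> exec q s t s' ->
    exec (If b p q) s (test_cost b + t).+1 s'
| ExecWhileFalse b p s :
    ~~ eval_test s b -> exec (While b p) s (test_cost b).+1 s
| ExecWhileTrue b p s t s1 t' s2 :
    eval_test s b -> exec p s t s1 -> exec (While b p) s1 t' s2 ->
    exec (While b p) s (test_cost b + t + t').+1 s2.

Lemma exec_deterministic p s t1 s1 t2 s2 :
  exec p s t1 s1 -> exec p s t2 s2 -> t1 = t2 /\ s1 = s2.
Proof.
move=> E; elim: E t2 s2 => {p s t1 s1};
  intros;
  match goal with
  | E : exec _ _ ?t2 ?s2 |- _ = ?t2 /\ _ = ?s2 => inversion E; subst
  end;
  repeat match goal with
  | H1 : is_true (~~ ?b), H2 : is_true ?b |- _ => by rewrite H2 in H1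
  | IH : forall t2 s2, exec ?p ?s t2 s2 -> _, E : exec ?p ?s ?t ?s' |- _ =>
      have [? ?] := IH _ _ E; clear IH; subst
  end; by [].
Qed.

Definition initial_state (input : seq nat) : state :=
  State (fun=> 0) (nth 0 input).

Definition output (s : state) : nat := reg s 0.
Definition YES : nat := 1.
Definition NO : nat := 0.

(** * Graphs as inputs

    [input] is an adjacency list representation of [G]: the nodes are numbered
    by their position in some enumeration [vs] of them, and the neighbors of
    each node [v] are listed once, in any order [nb v].  The memory holds

    - [n] in cell [0] and [m] in cell [1];
    - in cells [2 + i] and [2 + i + 1], for [i < n], the addresses of the first
      cell of the list of node number [i] and of the first cell after it;
    - from cell [n + 3] on, the lists of the nodes number [0], [1], ... in a
      row. *)
Definition adjacency_lists (G : sgraph) (input : seq nat) : Prop :=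
  exists (vs : seq G) (nb : G -> seq G),
    [/\ perm_eq vs (enum G),
        (forall v, perm_eq (nb v) (enum [pred u | edge v u]))
      & input =
          [:: num_nodes G; num_edges G] ++
          (num_nodes G + 3
             :: scanl addn (num_nodes G + 3) [seq size (nb v) | v <- vs]) ++
          flatten [seq [seq index u vs | u <- nb v] | v <- vs]].

(* Main.v *)
Require Import Defs.
From mathcomp Require Import all_boot zify.
Set Implicit Arguments.
Unset Strict Implicit.
Unset Printing Implicit Defensive.

(** [G] contains a propeller iff for some node [x] two neighbors of [x] lie on a
    common cycle of [G - x], that is, in a common block of [G - x] with at least
    three nodes.  For every [x] of positive degree, a depth-first search of [G]
    rooted at [x] and low points that ignore the edges at [x] give the blocks of
    [G - x] that meet the neighborhood of [x]: a node [v] lies in the block of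
    the edge above its parent iff some edge joins the subtree of [v] to a proper
    ancestor of the parent other than [x].  It then suffices to count the
    neighbors of [x] in each block.  A round costs O(n + m), and rounds take
    place only at the at most 2m nodes that have a neighbor. *)

(** * Array programs on the random access machine *)

(** The machine has no recursion, so the search keeps an explicit stack of directed edges. A node
    may wait there several times, and its parent is fixed only when it is first popped: marking
    nodes when they are pushed would lose the property that every edge joins a node to an ancestor,
    on which the block criterion rests. Rooting the search at [x] itself lets a single search reach
    all neighbors of [x]; the subtrees of its children are search trees of components of [G - x],
    which is why [x] must not count as a target of edges in low points. No stack of edges is needed
    to collect the blocks: low points are propagated in reverse preorder, and the heads that name
    the blocks in preorder. A block that is a single edge is the delicate case: both ends may be
    adjacent to [x], yet no cycle runs through it. Its count must therefore not be tested until a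
    further node joins. *)

(** [Res] is the answer; [VN], [VX], [VSp], [VK] hold the number of nodes, the
    center under test, the height of the stack, the number of visited nodes;
    [VA] and [VE] delimit the unread part of a list of neighbors. *)
Inductive var := Res | VN | VX | VSp | VV | VP | VA | VE | VK | VU | VL | VI | VH.
(** Indexed by nodes: the preorder number (0 if unvisited), the mark of the
    neighbors of the center, the parent, the low point, the topmost node [h] of
    the block of the edge above a node other than the cut node of that block, and
    the number of marked nodes in the block with head [h].
    [Ord] lists the nodes in preorder; [StkV] and [StkP] form the stack. *)
Inductive arr := Pre | Mk | Ord | Par | Low | Hd | Cnt | StkV | StkP.

Definition var_code (r : var) : nat :=
  match r with
  | Res => 1 | VN => 2 | VX => 3 | VSp => 4 | VV => 5 | VP => 6 | VA => 7
  | VE => 8 | VK => 9 | VU => 10 | VL => 11 | VI => 12 | VH => 13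
  end.

Definition arr_code (k : arr) : nat :=
  match k with
  | Pre => 0 | Mk => 1 | Ord => 2 | Par => 3 | Low => 4 | Hd => 5 | Cnt => 6
  | StkV => 7 | StkP => 8
  end.

Inductive aexpr :=
| ACst (k : nat)
| AR (r : var)
| AA (k : arr) (e : aexpr)
| AAdd (e1 e2 : aexpr)
| ASub (e1 e2 : aexpr).

Inductive atest := ALt (e1 e2 : aexpr) | AEq (e1 e2 : aexpr).

Inductive aprog :=
| ASkip
| ASet (r : var) (e : aexpr)
| ALoad (r : var) (e : aexpr)
| APut (k : arr) (i e : aexpr)
| ASeq (p q : aprog)
| AIf (b : atest) (p q : aprog)
| AWhile (b : atest) (p : aprog).

Record astate := AState { vr : var -> nat; ar : arr -> nat -> nat }.

Definition set_var (st : astate) (r : var) (v : nat) : astate :=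
  AState (fun r' => if var_code r' == var_code r then v else vr st r') (ar st).

Definition put (st : astate) (k : arr) (i v : nat) : astate :=
  AState (vr st)
    (fun k' => if arr_code k' == arr_code k then update (ar st k) i v
               else ar st k').

Fixpoint aeval (st : astate) (e : aexpr) : nat :=
  match e with
  | ACst k => k
  | AR r => vr st r
  | AA k e => ar st k (aeval st e)
  | AAdd e1 e2 => aeval st e1 + aeval st e2
  | ASub e1 e2 => aeval st e1 - aeval st e2
  end.

Definition ateval (st : astate) (b : atest) : bool :=
  match b with
  | ALt e1 e2 => aeval st e1 < aeval st e2
  | AEq e1 e2 => aeval st e1 == aeval st e2
  end.

(** There is no multiplication; four doublings give the stride 16, a power of two that exceeds every
    array code. *)
Definition double (e : expr) := Add e e.

(** Register 0 holds the first address above the input; from there on, cell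
    [i] of array [k] sits at offset [16 i + arr_code k], so that all arrays are
    unbounded. *)
Definition cell (k : arr) (e : expr) : expr :=
  Add (Add (Reg 0) (Const (arr_code k))) (double (double (double (double e)))).

Fixpoint cexpr (e : aexpr) : expr :=
  match e with
  | ACst k => Const k
  | AR r => Reg (var_code r)
  | AA k e => Read (cell k (cexpr e))
  | AAdd e1 e2 => Add (cexpr e1) (cexpr e2)
  | ASub e1 e2 => Defs.Sub (cexpr e1) (cexpr e2)
  end.

Definition ctest (b : atest) : test :=
  match b with
  | ALt e1 e2 => Lt (cexpr e1) (cexpr e2)
  | AEq e1 e2 => Eq (cexpr e1) (cexpr e2)
  end.

Fixpoint compile (p : aprog) : prog :=
  match p with
  | ASkip => Skip
  | ASet r e => Assign (var_code r) (cexpr e)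
  | ALoad r e => Assign (var_code r) (Read (cexpr e))
  | APut k i e => Write (cell k (cexpr i)) (cexpr e)
  | ASeq p q => Seq (compile p) (compile q)
  | AIf b p q => If (ctest b) (compile p) (compile q)
  | AWhile b p => While (ctest b) (compile p)
  end.

Lemma var_code_gt0 r : 0 < var_code r.
Proof. by case: r. Qed.

Lemma arr_code_lt k : arr_code k < 16.
Proof. by case: k. Qed.

Lemma arr_code_inj : injective arr_code.
Proof. by do 2!case. Qed.

(** A time bound for loop-free programs, which charges both branches of a test; loops are timed by
    the rules for [runs]. *)
Fixpoint prog_cost (p : prog) : nat :=
  match p with
  | Skip => 1
  | Assign r e => (expr_cost e).+1
  | Write a e => (expr_cost a + expr_cost e).+1
  | Seq p q => prog_cost p + prog_cost q
  | If b p q => (test_cost b + (prog_cost p + prog_cost q)).+1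
  | While b p => 0
  end.

(** Large enough for every loop-free piece of the program, so that [runs] below
    only has to count such pieces. *)
Definition unit_time : nat := 2000.

(** * Timed total correctness and rules for loops *)

Section Runs.
Variables (base : nat) (inp : nat -> nat).

Definition rep (st : astate) (s : state) : Prop :=
  [/\ reg s 0 = base,
      forall r, reg s (var_code r) = vr st r,
      forall a, a < base -> Defs.mem s a = inp a
    & forall k i, Defs.mem s (base + arr_code k + 16 * i) = ar st k i].

(** Total correctness from every machine state that represents [st]. The bound [T] counts pieces of
    cost at most [unit_time], so that the exact cost of an instruction never enters an invariant. *)
Definition runs (p : aprog) (T : nat) (Q : astate -> Prop) (st : astate) : Prop :=
  forall s, rep st s -> exists t s' st',
    [/\ exec (compile p) s t s', t <= unit_time * T, rep st' s' & Q st'].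

(** Symbolic execution of loop-free pieces. A load has to stay below [base], the region where the
    memory still equals the input. *)
Fixpoint wp (p : aprog) (Q : astate -> Prop) (st : astate) : Prop :=
  match p with
  | ASkip => Q st
  | ASet r e => Q (set_var st r (aeval st e))
  | ALoad r e => aeval st e < base /\ Q (set_var st r (inp (aeval st e)))
  | APut k i e => Q (put st k (aeval st i) (aeval st e))
  | ASeq p q => wp p (wp q Q) st
  | AIf b p q => if ateval st b then wp p Q st else wp q Q st
  | AWhile b p => False
  end.

Lemma eval_cell s k e :
  eval s (cell k e) = reg s 0 + arr_code k + 16 * eval s e.
Proof. by rewrite /cell /double /=; lia. Qed.

Lemma eval_cexpr st s e : rep st s -> eval s (cexpr e) = aeval st e.
Proof.
move=> [B V I A]; elim: e => [k|r|k e IH|e1 IH1 e2 IH2|e1 IH1 e2 IH2] //.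
- exact: V.
- by rewrite [RHS]/= -A -IH -B -eval_cell.
- by rewrite /= IH1 IH2.
- by rewrite /= IH1 IH2.
Qed.

Lemma eval_ctest st s b : rep st s -> eval_test s (ctest b) = ateval st b.
Proof. by move=> R; case: b => e1 e2 /=; rewrite !(eval_cexpr _ R). Qed.

Lemma rep_set st s r v :
  rep st s -> rep (set_var st r v) (State (update (reg s) (var_code r) v) (Defs.mem s)).
Proof.
move=> [B V I A]; split=> //=.
- by rewrite /update; have := var_code_gt0 r; case: eqP => // <-.
- by move=> r'; rewrite /update V.
Qed.

Lemma rep_put st s k i v :
  rep st s ->
  rep (put st k i v)
    (State (reg s) (update (Defs.mem s) (base + arr_code k + 16 * i) v)).
Proof.
move=> [B V I A]; split=> //=.
- by move=> a lta; rewrite /update; case: eqP => [|_]; [lia | exact: I].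
(* Division by 16 recovers array and index from an address, so distinct cells do not overlap. *)
- move=> k' i'; have := arr_code_lt k; have := arr_code_lt k'.
  rewrite /update; case: (eqVneq (arr_code k') (arr_code k)) => [ek|nk] l1 l2.
    have -> : k' = k by apply: arr_code_inj.
    case: (eqVneq i' i) => [->|ni]; first by rewrite eqxx.
    by rewrite A; case: eqP => //; lia.
  by rewrite A; case: eqP => //; move: nk; lia.
Qed.

Lemma wp_exec p Q st s : rep st s -> wp p Q st -> exists t s' st',
  [/\ exec (compile p) s t s', t <= prog_cost (compile p), rep st' s' & Q st'].
Proof.
elim: p Q st s => [|r e|r e|k i e|p IHp q IHq|b p IHp q IHq|b p IHp] Q st s R //=.
- by move=> H; exists 1, s, st; split=> //; apply: ExecSkip.
- move=> H; do 3!eexists; split; [exact: ExecAssign | by [] | | exact: H].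
  by rewrite (eval_cexpr _ R); apply: rep_set.
- move=> [ltb H]; do 3!eexists; split; [exact: ExecAssign | by [] | | exact: H].
  have [_ _ I _] := R.
  by rewrite /= (eval_cexpr _ R) I //; apply: rep_set.
- move=> H; do 3!eexists; split; [exact: ExecWrite | by [] | | exact: H].
  rewrite -/(cell k (cexpr i)) eval_cell !(eval_cexpr _ R).
  by have [-> _ _ _] := R; apply: rep_put.
- move=> H; have [t [s1 [st1 [E1 l1 R1 H1]]]] := IHp _ _ _ R H.
  have [t' [s2 [st2 [E2 l2 R2 H2]]]] := IHq _ _ _ R1 H1.
  exists (t + t'), s2, st2; split=> //; first exact: ExecSeq E1 E2.
  exact: leq_add.
- case: ifP => [bT|bF] H.
    have [t [s1 [st1 [E1 l1 R1 H1]]]] := IHp _ _ _ R H.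
    exists (test_cost (ctest b) + t).+1, s1, st1; split=> //; last lia.
    by apply: ExecIfTrue => //; rewrite (eval_ctest _ R).
  have [t [s1 [st1 [E1 l1 R1 H1]]]] := IHq _ _ _ R H.
  exists (test_cost (ctest b) + t).+1, s1, st1; split=> //; last lia.
  by apply: ExecIfFalse => //; rewrite (eval_ctest _ R) bF.
Qed.

Lemma runs_wp p Q st :
  prog_cost (compile p) <= unit_time -> wp p Q st -> runs p 1 Q st.
Proof.
move=> lp H s R; have [t [s' [st' [E l R' H']]]] := wp_exec R H.
by exists t, s', st'; split=> //; rewrite muln1; apply: leq_trans lp.
Qed.

Lemma runs_weaken p T T' (Q Q' : astate -> Prop) st :
  T <= T' -> (forall st, Q st -> Q' st) -> runs p T Q st -> runs p T' Q' st.
Proof.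
move=> lT QQ' H s R; have [t [s' [st' [E l R' H']]]] := H s R.
exists t, s', st'; split=> //; last exact: QQ'.
by apply: leq_trans l _; rewrite leq_mul2l lT orbT.
Qed.

Lemma runs_seq p q T1 T2 Q st :
  runs p T1 (runs q T2 Q) st -> runs (ASeq p q) (T1 + T2) Q st.
Proof.
move=> H s R; have [t [s1 [st1 [E l R1 H1]]]] := H s R.
have [t' [s2 [st2 [E' l' R2 H2]]]] := H1 s1 R1.
exists (t + t'), s2, st2; split=> //; first exact: ExecSeq E E'.
by rewrite mulnDr leq_add.
Qed.

Lemma runs_if b p q T Q st :
  test_cost (ctest b) < unit_time ->
  (if ateval st b then runs p T Q st else runs q T Q st) ->
  runs (AIf b p q) T.+1 Q st.
Proof.
move=> lb H s R; case: ifP H => bT H;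
  have [t [s1 [st1 [E l R1 H1]]]] := H s R;
  exists (test_cost (ctest b) + t).+1, s1, st1; split=> //.
- by apply: ExecIfTrue => //; rewrite (eval_ctest _ R).
- by rewrite mulnS; lia.
- by apply: ExecIfFalse => //; rewrite (eval_ctest _ R) bT.
- by rewrite mulnS; lia.
Qed.

(** The invariant is indexed by the time that remains, which also bounds the
    number of iterations. *)
Lemma runs_while b p (Inv : nat -> astate -> Prop) Q :
  test_cost (ctest b) < unit_time ->
  (forall T st, Inv T st -> ateval st b ->
    exists T1,
      runs p T1 (fun st' => exists2 T2, Inv T2 st' & T1 + T2 < T) st) ->
  (forall T st, Inv T st -> ~~ ateval st b -> 0 < T /\ Q st) ->
  forall T st, Inv T st -> runs (AWhile b p) T Q st.
Proof.
move=> lb body exit T; elim/ltn_ind: T => T IH st inv s R.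
case bT: (ateval st b).
  have [T1 H] := body _ _ inv bT.
  have [t [s1 [st1 [E l R1 [T2 inv2 lT]]]]] := H s R.
  have ltT2 : T2 < T by lia.
  have [t' [s2 [st2 [E' l' R2 H2]]]] := IH T2 ltT2 st1 inv2 s1 R1.
  exists (test_cost (ctest b) + t + t').+1, s2, st2; split=> //.
    by apply: ExecWhileTrue E E'; rewrite (eval_ctest _ R).
  have : unit_time * (T1 + T2).+1 <= unit_time * T by rewrite leq_mul2l lT orbT.
  by rewrite mulnS mulnDr; lia.
have [T0 H] := exit _ _ inv (negbT bT).
exists (test_cost (ctest b)).+1, s, st; split=> //.
  by apply: ExecWhileFalse; rewrite (eval_ctest _ R) bT.
by apply: leq_trans lb _; rewrite -{1}(muln1 unit_time) leq_mul2l T0 orbT.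
Qed.

(** The counter [i] determines the remaining time, namely the tail of the sum from [i] on, which
    turns [J] into an invariant for [runs_while]. *)
Lemma runs_for b p (J : nat -> astate -> Prop) (N : nat) (c : nat -> nat) Q :
  test_cost (ctest b) < unit_time ->
  (forall i st, i < N -> J i st -> ateval st b /\ runs p (c i) (J i.+1) st) ->
  (forall st, J N st -> ~~ ateval st b /\ Q st) ->
  forall st, J 0 st -> runs (AWhile b p) (\sum_(0 <= i < N) (c i).+1).+1 Q st.
Proof.
move=> lb body exit st J0.
pose Inv T st :=
  exists i, [/\ i <= N, J i st & T = (\sum_(i <= j < N) (c j).+1).+1].
apply: (@runs_while b p Inv) => //; last by exists 0.
- move=> T st1 [i [leiN Ji ->]] bT.
  have ltiN : i < N.
    rewrite ltn_neqAle leiN andbT; apply: contraL bT => /eqP eiN.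
    by have [] := exit st1 _; rewrite -?eiN.
  exists (c i); have [_] := body _ _ ltiN Ji.
  apply: runs_weaken => // st2 J2.
  exists (\sum_(i.+1 <= j < N) (c j).+1).+1; first by exists i.+1.
  by rewrite (big_ltn ltiN); lia.
- move=> T st1 [i [leiN Ji ->]] bF; split=> //.
  suff eiN : i = N by have [] := exit st1 _; rewrite -?eiN.
  apply/eqP; rewrite eqn_leq leiN /= leqNgt; apply: contra bF => ltiN.
  by have [] := body _ _ ltiN Ji.
Qed.

Lemma runs_loop b p (J : nat -> astate -> Prop) (N : nat) Q :
  test_cost (ctest b) < unit_time ->
  (forall i st, i < N -> J i st -> ateval st b /\ runs p 1 (J i.+1) st) ->
  (forall st, J N st -> ~~ ateval st b /\ Q st) ->
  forall st, J 0 st -> runs (AWhile b p) (2 * N).+1 Q st.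
Proof.
move=> lb body exit st J0.
have := runs_for (c := fun=> 1) lb body exit J0.
by rewrite sum_nat_const_nat subn0 mulnC.
Qed.

End Runs.

(** * Common cycles in 2-connected sets *)

(** [lia] is very slow in the presence of many unrelated boolean hypotheses. *)
Ltac arith :=
  repeat match goal with
  | H : ?P |- _ =>
    lazymatch P with
    | is_true (leq _ _) => fail
    | @eq nat _ _ => fail
    | _ => clear H
    end
  end; lia.

Section Whitney.
Variables (T : finType) (e : rel T).
Hypothesis e_sym : symmetric e.
Hypothesis e_irr : irreflexive e.

Definition common_cycle (B : {set T}) (y z : T) : Prop :=
  exists C : seq T,
    [/\ 2 < size C, uniq C, cycle e C, {subset C <= B} & y \in C /\ z \in C].

Lemma cycle_flip u r : cycle e (u :: rev r) = cycle e (u :: r).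
Proof.
rewrite -rev_rcons rev_cycle -rot1_cons rot_cycle.
by apply: eq_cycle => a b /=; rewrite e_sym.
Qed.

(** The ear [q] from [u] to [a] replaces the arc [r1]; the other arc survives, hence so does [y] if
    it lies there. *)
Lemma ear_cycle_aux u r1 a r2 q y :
  uniq (u :: r1 ++ a :: r2) -> cycle e (u :: r1 ++ a :: r2) ->
  uniq q -> q != [::] -> ~~ has [in u :: r1 ++ a :: r2] q ->
  path e u (rcons q a) -> y \in u :: a :: r2 ->
  exists C, [/\ 2 < size C, uniq C, cycle e C,
    {subset C <= (u :: r1 ++ a :: r2) ++ q} & {subset y :: q <= C}].
Proof.
move=> uC cC uq q0 dq pq yin; exists (u :: q ++ a :: r2); split.
- by case: q q0 {uq dq pq} => //= b q _; rewrite size_cat /=; lia.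
- rewrite -cat1s uniq_catCA cat_uniq uq andTb; apply/andP; split.
    apply: contra dq => /hasP[c cs /= cq]; apply/hasP; exists c => //=.
    by move: cs; rewrite !inE mem_cat !inE => /or3P[] ->; rewrite ?orbT.
  by apply: subseq_uniq uC; rewrite /= eqxx suffix_subseq.
- move: cC; rewrite /= !rcons_cat !cat_path /= => /and3P[_ _ ->].
  by move: pq; rewrite rcons_path => /andP[-> ->].
- move=> c; rewrite !(inE, mem_cat).
  by case/or4P => ->; rewrite ?orbT.
- move=> c; rewrite !(inE, mem_cat); case/orP => [/eqP->|->]; rewrite ?orbT //.
  by move: yin; rewrite !inE => /or3P[] ->; rewrite ?orbT.
Qed.

(** The ear has to replace an arc without [y] in its interior. If that is the wrong one, reversing
    the cycle about [u] swaps the two arcs. *)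
Lemma ear_cycle C u a q y :
  uniq C -> cycle e C -> u \in C -> a \in C -> a != u -> y \in C ->
  uniq q -> q != [::] -> ~~ has [in C] q -> path e u (rcons q a) ->
  exists C', [/\ 2 < size C', uniq C', cycle e C',
    {subset C' <= C ++ q} & {subset y :: q <= C'}].
Proof.
move=> uC cC uin ain nau yin uq q0 dq pq.
have [i r Er] := rot_to uin.
have memC : C =i u :: r by move=> c; rewrite -Er mem_rot.
move: uC cC ain yin; rewrite -(rot_uniq i) -(rot_cycle i) Er !memC !inE (negPf nau) orFb.
move=> uC cC /splitPr ar; case: ar uC cC memC => r1 r2 uC cC memC yin.
have {}dq : ~~ has [in u :: r1 ++ a :: r2] q.
  by rewrite -(eq_has memC).
have [yin2|nyin2] := boolP (y \in u :: a :: r2).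
  have [C' [sC uC' cC' sub1 sub2]] := ear_cycle_aux uC cC uq q0 dq pq yin2.
  by exists C'; split=> // c /sub1; rewrite !mem_cat memC.
have revE : rev (r1 ++ a :: r2) = rev r2 ++ a :: rev r1.
  by rewrite rev_cat rev_cons cat_rcons.
have memC' : u :: r1 ++ a :: r2 =i u :: rev r2 ++ a :: rev r1.
  by move=> c; rewrite -revE !inE mem_rev.
move: uC cC dq; rewrite -cycle_flip (eq_has memC') revE => uC cC dq.
have [||C' [sC uC' cC' sub1 sub2]] := @ear_cycle_aux u _ a _ q y _ cC uq q0 dq pq.
- by move: uC; rewrite -revE /= mem_rev rev_uniq.
- move: yin nyin2; rewrite !(inE, mem_cat, mem_rev).
  by case/or4P => ->; rewrite ?orbT.
by exists C'; split=> // c /sub1; rewrite !mem_cat memC memC'.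
Qed.

(** The graph on [B] with [w] deleted; that it is connected for every [w] is the form in which
    2-connectedness is used. *)
Definition within (B : {set T}) (w : T) : rel T :=
  [rel a b | [&& e a b, a \in B, b \in B, a != w & b != w]].

Lemma within_sym B w : symmetric (within B w).
Proof.
move=> a b; rewrite /within /= e_sym; congr (_ && _).
by rewrite andbCA [(b != w) && _]andbC.
Qed.

Lemma within_path B w x p :
  path (within B w) x p ->
  [/\ path e x p, {subset p <= B} & w \notin p].
Proof.
elim: p x => [|y p IH] x //= /andP[/and5P[exy _ yB _ nyw] /IH[P S N]].
rewrite exy inE eq_sym (negPf nyw); split=> // c.
by rewrite inE => /orP[/eqP->|/S].
Qed.

(** Induction along a path from [y] to [z]: a path that leaves the cycle through
    an edge [u w] comes back to it without using [u], and this ear extends one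
    of the two arcs of the cycle. *)
Lemma common_cycle_of_2connected (B : {set T}) y z :
  2 < #|B| ->
  (forall w a b, w \in B -> a \in B -> b \in B -> a != w -> b != w ->
     connect (within B w) a b) ->
  y \in B -> z \in B -> y != z -> common_cycle B y z.
Proof.
move=> B3 conn yB zB nyz.
have third a b : exists c, [/\ c \in B, c != a & c != b].
  have [c] : exists c, c \in B :\: [set a; b].
    apply/set0Pn; rewrite -card_gt0 cardsD; have := cards2 a b.
    have := subset_leq_card (subsetIr B [set a; b]).
    by case: (a != b); lia.
  by rewrite !inE negb_or => /andP[/andP[? ?] ?]; exists c.
pose good u := u = y \/ common_cycle B y u.
have step u w : u \in B -> w \in B -> e u w -> good u -> good w.
  move=> uB wB euw gu; have [->|nwy] := eqVneq w y; first by left.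
  (* For [u = y] there is no cycle to extend yet. A path from [y] to a third node that avoids [w]
     starts with a neighbor [s] of [y] other than [w], and a path from [w] to [s] that avoids [y]
     closes a cycle. *)
  right; have [uy|nuy] := eqVneq u y.
    have [t [tB ntw nty]] := third w y.
    have nyw : y != w by rewrite eq_sym.
    have /connectP[[|s p0] /=] := conn w y t wB yB tB nyw ntw.
      by move=> _ ty; rewrite ty eqxx in nty.
    case/andP => /and5P[eys _ sB _ nsw] _ _.
    have nsy : s != y by apply: contraTneq eys => ->; rewrite e_irr.
    have /connectP[p' pp'] := conn y w s yB wB sB nwy nsy.
    case: (shortenP pp') => p {}pp up _ Els.
    have [P S N] := within_path pp.
    exists (y :: w :: p); split.
    - by case: p pp up Els {P S N} => //= _ _ sw; rewrite sw eqxx in nsw.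
    - by rewrite /= in up *; rewrite up inE negb_or eq_sym nwy N.
    - by rewrite /= rcons_path P -uy euw -Els uy e_sym eys.
    - by move=> c; rewrite !inE => /or3P[/eqP->|/eqP->|/S].
    - by rewrite !inE !eqxx orbT.
  case: gu => [uy|[C [sC uC cC subC [yC uinC]]]]; first by rewrite uy eqxx in nuy.
  have [wC|nwC] := boolP (w \in C); first by exists C.
  have nwu : w != u by apply: contraTneq euw => ->; rewrite e_irr.
  have nyu : y != u by rewrite eq_sym.
  have /connectP[p' pp'] := conn u w y uB wB yB nwu nyu.
  case: (shortenP pp') => p {}pp up _ Els.
  have [P S N] := within_path pp.
  have hasC : has [in C] p.
    apply/hasP; exists y => //; rewrite Els.
    have := mem_last w p; rewrite inE => /orP[/eqP lw|//].
    by move: yC; rewrite Els lw (negPf nwC).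
  case: (split_find hasC) Els P S N up => a q p2 aC nq _.
  rewrite cat_path rcons_path -andbA => /and3P[pq eqa _] S N up.
  have [||||||C' [sC' uC' cC' sub1 sub2]] := @ear_cycle C u a (w :: q) y uC cC uinC aC.
  - by apply: contraNneq N => <-; rewrite mem_cat mem_rcons inE eqxx.
  - exact: yC.
  - by move: up; rewrite -cat_cons cat_uniq -rcons_cons rcons_uniq => /and3P[/andP[_]].
  - by [].
  - by rewrite /= negb_or nwC.
  - by rewrite /= euw rcons_path pq.
  - exists C'; split=> //; last by split; apply: sub2; rewrite !inE eqxx ?orbT.
    move=> c /sub1; rewrite mem_cat inE => /or3P[/subC|/eqP->|cq] //.
    by apply: S; rewrite mem_cat mem_rcons inE cq orbT.
(* Connectivity is available only with a node deleted, so a third node [t] is sacrificed to get a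
   path from [y] to [z]. *)
have [t [tB nty ntz]] := third y z.
have nyt : y != t by rewrite eq_sym.
have nzt : z != t by rewrite eq_sym.
have /connectP[p] := conn t y z tB yB zB nyt nzt.
have gy : good y by left.
suff walk b : b \in B -> good b -> path (within B t) b p -> z = last b p ->
    common_cycle B y z by exact: walk.
elim: p b => [|a p IH] b bB gb /=.
  move=> _ zb; case: gb => [eb|]; last by rewrite -zb.
  by rewrite zb eb eqxx in nyz.
case/andP => /and5P[eba _ aB _ _]; apply: IH => //; exact: step gb.
Qed.

End Whitney.

(** * Propellers as cycles *)

Definition propeller_at (G : sgraph) (x : G) : Prop :=
  exists y z, [/\ edge x y, edge x z, y != z
    & common_cycle (@edge G) (~: [set x]) y z].

Lemma propeller_at_of_contains (G : sgraph) :
  contains_propeller G -> exists x : G, propeller_at x.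
Proof.
case=> F [[C [x [[sC uC cC _] xC _ two]]] [H [f [bij_f ef]]]].
have inj_f : injective f by exact: bij_inj.
pose g := val \o f; have inj_g : injective g by exact: inj_comp val_inj inj_f.
have eg a b : edge a b -> edge (g a) (g b).
  by rewrite -ef => /(sub_edgeP (s := H)) /and3P[].
have [y [z [yin zin nyz]]] := card_gt1P two.
move: yin zin; rewrite !inE => /andP[yC xy] /andP[zC xz].
exists (g x), (g y), (g z); split; rewrite ?eg ?(inj_eq inj_g) //.
exists (map g C); split; rewrite ?size_map ?map_inj_uniq //.
- by rewrite cycle_map; apply: sub_cycle cC => a b; exact: eg.
- by move=> c /mapP[d dC ->]; rewrite !inE (inj_eq inj_g); apply: contraNneq xC => <-.
- by split; apply: map_f.
Qed.

Section BuildPropeller.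
Variables (G : sgraph) (x : G) (C : seq G).
Hypotheses (sC : 2 < size C) (uC : uniq C) (cC : cycle (@edge G) C) (xC : x \notin C).

(** Only the rim and the spokes are kept. A subgraph need not be induced, so dropping the chords of
    [C] turns any cycle into a chordless rim. *)
Definition propeller_edge : rel G := fun u v =>
  edge u v && [|| [&& u \in C, v \in C & (v == next C u) || (u == next C v)],
                  (u == x) && (v \in C) | (v == x) && (u \in C)].

Lemma propeller_edgeP u v : propeller_edge u v ->
  [&& u \in [set w | (w == x) || (w \in C)],
      v \in [set w | (w == x) || (w \in C)] & edge u v].
Proof.
rewrite !inE => /andP[-> /or3P[/and3P[-> -> _]|/andP[-> ->]|/andP[-> ->]]];
by rewrite !orbT.
Qed.

Lemma propeller_edge_sym : symmetric propeller_edge.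
Proof.
move=> u v; rewrite /propeller_edge edge_sym; congr (_ && _).
rewrite andbCA [(_ == next _ _) || _]orbC; congr (_ || _); exact: orbC.
Qed.

Definition propeller_subgraph : subgraph G :=
  Subgraph propeller_edgeP propeller_edge_sym.

Lemma contains_propeller_of_cycle y z :
  y \in C -> z \in C -> y != z -> edge x y -> edge x z -> contains_propeller G.
Proof.
move=> yC zC nyz xy xz.
pose F := graph_of_subgraph propeller_subgraph.
exists F; split; last by exists propeller_subgraph, id; split=> //; exists id.
have inH u : (u == x) || (u \in C) -> u \in sub_nodes propeller_subgraph by rewrite inE.
have xH : x \in sub_nodes propeller_subgraph by rewrite inH ?eqxx.
pose x' : F := exist _ x xH.
pose C' : seq F := map (insubd x') C.
have valC' u : u \in C -> val (insubd x' u : F) = u.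
  by move=> uC'; rewrite val_insubd inH // uC' orbT.
have mapC' : map val C' = C.
  by rewrite -map_comp -[RHS]map_id; apply/eq_in_map => u /valC'.
have memC' (u : F) : (u \in C') = (val u \in C).
  by rewrite -[in RHS]mapC' mem_map //; exact: val_inj.
have uniqC' : uniq C' by rewrite -(map_inj_uniq val_inj) mapC'.
exists C', x'; split; first split.
- by rewrite size_map.
- by [].
- have: cycle propeller_edge C.
    apply: cycle_from_next => // u uC'.
    by rewrite /propeller_edge (next_cycle cC uC') uC' mem_next uC' eqxx.
  by rewrite -{1}mapC' cycle_map; apply: sub_cycle.
- move=> u v; rewrite !memC' => uC' vC'.
  move=> /andP[_ /or3P[/and3P[_ _]|/andP[/eqP ux]|/andP[/eqP vx]]].
  + rewrite -mapC' !(next_map (val_inj : injective (val : F -> G))) //.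
    by rewrite !(inj_eq val_inj) => /orP[] /eqP ->; [left|right].
  + by rewrite ux (negPf xC) in uC'.
  + by rewrite vx (negPf xC) in vC'.
- by rewrite memC'.
- move=> u; have := valP u; rewrite inE => /orP[/eqP ux|uC']; last by right; rewrite memC'.
  by left; apply: val_inj.
- apply/card_gt1P; exists (insubd x' y), (insubd x' z).
  have E u : u \in C -> edge x u -> insubd x' u \in [set y in C' | edge x' y].
    move=> uC' xu; rewrite inE memC' valC' // uC' /= /edge /= /restricted_edge /=.
    by rewrite valC' // /propeller_edge xu uC' eqxx orbT.
  split; [exact: E | exact: E |].
  by rewrite -(inj_eq val_inj) !valC'.
Qed.
End BuildPropeller.

Lemma contains_propellerP (G : sgraph) :
  contains_propeller G <-> exists x : G, propeller_at x.
Proof.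
split; first exact: propeller_at_of_contains.
case=> x [y [z [xy xz nyz [C [sC uC cC subC [yC zC]]]]]].
have xC : x \notin C by apply/negP => /subC; rewrite !inE eqxx.
exact: (contains_propeller_of_cycle (C := C) (x := x)) xy xz.
Qed.


(** Each dart is sent to its edge, and a fibre contains at most the two orientations. *)
Lemma card_darts (G : sgraph) :
  \sum_(v : G) #|[pred u | edge v u]| <= 2 * num_edges G.
Proof.
pose D := [set p : G * G | edge p.1 p.2].
have -> : \sum_(v : G) #|[pred u | edge v u]| = #|D|.
  rewrite -sum1_card; under eq_bigr => v _ do rewrite -sum1_card.
  by rewrite pair_big_dep /=; apply: eq_bigl => -[a b]; rewrite [RHS]inE.
pose f (p : G * G) : {set G} := [set p.1; p.2].
rewrite -sum1_card (partition_big f (mem (edge_set G))); last first.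
  by move=> p; rewrite inE => ep; apply/imsetP; exists p; rewrite ?inE.
rewrite mulnC /num_edges -sum_nat_const; apply: leq_sum => s _.
have [[a b] /= abD|none] := pickP [pred p | (p \in D) && (f p == s)]; last first.
  by rewrite big_pred0.
case/andP: abD => _ /eqP fab.
rewrite sum1dep_card; apply: leq_trans (_ : #|[set (a, b); (b, a)]| <= 2); last first.
  by rewrite cards2; case: eqP.
apply: subset_leq_card; apply/subsetP => -[c d]; rewrite !inE /= -fab => /andP[ecd /eqP].
move=> E; have : c \in f (a, b) by rewrite -E !inE eqxx.
have : d \in f (a, b) by rewrite -E !inE eqxx orbT.
have : a \in f (c, d) by rewrite E !inE eqxx.
have : b \in f (c, d) by rewrite E !inE eqxx orbT.
have : c != d by apply: contraTneq ecd => ->; rewrite edge_irr.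
rewrite !inE /= -!pair_eqE /= => ncd.
move=> /orP[]/eqP-> /orP[]/eqP->; rewrite ?eqxx ?orbT ?(negPf ncd) //= => _ _.
Qed.

(** * Blocks from a depth-first search tree *)

Section NormalTree.
Variables (T : finType) (e : rel T).
Hypothesis e_sym : symmetric e.
Hypothesis e_irr : irreflexive e.

(** [fconnect par v u] says that [u] is an ancestor of [v] or [v] itself; iteration of [par] stops
    at the root because of the loop there. The field [nt_back] is the mark of a depth-first tree:
    edges join comparable nodes only. *)
Record normal_tree (x : T) (o : seq T) (par : T -> T) : Prop := NormalTree {
  nt_root : index x o = 0;
  nt_par_root : par x = x;
  nt_par : forall v, v \in o -> v != x ->
    [/\ par v \in o, index (par v) o < index v o & e (par v) v];
  nt_closed : forall u v, u \in o -> e u v -> v \in o;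
  nt_back : forall u v, u \in o -> v \in o -> e u v ->
    index u o < index v o -> fconnect par v u
}.

Section Blocks.
Variables (x : T) (o : seq T) (par : T -> T).
Hypothesis nt : normal_tree x o par.
Local Notation idx v := (index v o).
Local Notation anc u v := (fconnect par v u).

Lemma anc_in u v : v \in o -> anc u v -> (u \in o) /\ idx u <= idx v.
Proof.
move=> vo /connectP[p pp ->] {u}.
elim: p v vo pp => [|a p IH] v vo //= /andP[/eqP <- {a} pp].
have [evx|nvx] := eqVneq v x.
  rewrite evx (nt_par_root nt) in pp vo *; exact: IH.
have [po lt _] := nt_par nt vo nvx.
by have [? ?] := IH _ po pp; split=> //; arith.
Qed.

Lemma idx_inj u v : u \in o -> idx u = idx v -> u = v.
Proof.
move=> uo E; have vo : v \in o by rewrite -index_mem -E index_mem.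
by rewrite -(nth_index u uo) E nth_index.
Qed.

Lemma anc_par u v : anc u v -> u != v -> anc u (par v).
Proof.
move=> /connectP[[|a p] /=]; first by move=> _ ->; rewrite eqxx.
by case/andP => /eqP -> pp -> _; apply/connectP; exists p.
Qed.

Lemma par_anc v : anc (par v) v.
Proof. exact: fconnect1. Qed.

Lemma anc_iter u v : anc u v -> exists k, u = iter k par v.
Proof. by move=> H; exists (findex par v u); rewrite iter_findex. Qed.

(** Both nodes are iterates of [par] at [s], and the one reached by more steps lies above the other;
    the indices tell which one it is. *)
Lemma anc_total a b s : s \in o -> anc a s -> anc b s -> idx a <= idx b -> anc a b.
Proof.
move=> so aas abs; have [i ai] := anc_iter aas; have [j bj] := anc_iter abs.
have [ao _] := anc_in so aas; have [bo _] := anc_in so abs.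
have [le_ji|lt_ij] := leqP j i.
  by move=> _; rewrite ai -(subnK le_ji) iterD -bj; exact: fconnect_iter.
have ba : anc b a.
  by rewrite bj -(subnK (ltnW lt_ij)) iterD -ai; exact: fconnect_iter.
have [_ leba] := anc_in ao ba => leab.
by have -> : a = b by apply: idx_inj => //; arith.
Qed.

Lemma anc_child w v : v \in o -> anc w v -> w != v ->
  exists c, [/\ anc c v, par c = w, c != x & idx w < idx c].
Proof.
move=> vo /connectP[p pp Ew].
elim: p v vo pp Ew => [|a p IH] v vo /=; first by move=> _ ->; rewrite eqxx.
case/andP => /eqP <- pp Ew nwv {a}.
have nvx : v != x.
  apply: contraNneq nwv => evx; have: anc w v.
    by apply/connectP; exists (par v :: p) => //=; rewrite eqxx.
  rewrite evx => /(anc_in _)[]; first by rewrite -evx.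
  move=> wo; rewrite (nt_root nt) leqn0 => /eqP w0.
  by rewrite (@idx_inj w x) // w0 (nt_root nt).
have [po lt _] := nt_par nt vo nvx.
have [epw|npw] := eqVneq w (par v).
  by exists v; split=> //; rewrite epw.
have [c [cp pc ncx ltc]] := IH _ po pp Ew npw.
by exists c; split=> //; apply: connect_trans cp; exact: par_anc.
Qed.

Lemma anc_edge s u : s \in o -> e s u -> anc s u \/ anc u s.
Proof.
move=> so esu; have uo := nt_closed nt so esu.
have nsu : s != u by apply: contraTneq esu => ->; rewrite e_irr.
have := ltngtP (idx s) (idx u) => -[lt|lt|E].
- by left; apply: (nt_back nt).
- by right; apply: (nt_back nt) => //; rewrite e_sym.
- by rewrite (idx_inj so E) eqxx in nsu.
Qed.

(** Blocks are studied for an abstract [m], apart from the low points that later compute it. In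
    [mP], [u] and [par v] are both ancestors of [s], so the smaller index makes [u] a proper
    ancestor of [par v]. *)
Variables (m : pred T) (hd : T -> T).
Hypothesis mP : forall v, v \in o -> v != x ->
  (m v <-> exists s u, [/\ anc v s, s \in o, e s u, u != x & idx u < idx (par v)]).
Hypothesis m_root : m x = false.
Hypothesis hdE : forall v, v \in o -> hd v = if m v then hd (par v) else v.

(** [par h] is the topmost node of the block and belongs to it although its own head differs. For a
    child [h] of the root in [o] the set is just [x] and [h]. *)
Definition block (h : T) : {set T} :=
  par h |: [set u in o | (u != x) && (hd u == h)].

Lemma m_neq v : m v -> v != x.
Proof. by apply: contraTneq => ->; rewrite m_root. Qed.

Lemma hd_anc v : v \in o -> anc (hd v) v /\ m (hd v) = false.
Proof.
have [k] := ubnP (idx v); elim: k v => // k IH v ltk vo.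
rewrite hdE //; case mv: (m v); last by split.
have [po lt _] := nt_par nt vo (m_neq mv).
have [|a1 a2] := IH (par v) _ po; first arith.
by split=> //; apply: connect_trans a1; exact: par_anc.
Qed.

Lemma hd_chain v c : v \in o -> anc (hd v) c -> anc c v -> hd c = hd v.
Proof.
have [k] := ubnP (idx v); elim: k v => // k IH v ltk vo.
have [ecv|ncv] := eqVneq c v; first by rewrite ecv.
rewrite (hdE vo); case: ifP => [mv hc cv|_ vc cv].
  have [po lt _] := nt_par nt vo (m_neq mv).
  by apply: IH => //; [arith | exact: anc_par].
have [co le1] := anc_in vo cv; have [_ le2] := anc_in co vc.
by rewrite (@idx_inj c v) ?eqxx in ncv => //; arith.
Qed.

Lemma hd_eq h v : v \in o -> anc h v -> m h = false ->
  (forall c, anc h c -> anc c v -> c != h -> m c) -> hd v = h.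
Proof.
have [k] := ubnP (idx v); elim: k v => // k IH v ltk vo hv mh ch.
have [ehv|nhv] := eqVneq v h; first by rewrite hdE // ehv mh.
have mv : m v by apply: ch.
have [po lt _] := nt_par nt vo (m_neq mv).
rewrite hdE // mv; apply: IH => //; first arith.
  by apply: anc_par; rewrite // eq_sym.
by move=> c hc cp; apply: ch => //; apply: connect_trans cp; exact: par_anc.
Qed.

Lemma hd_m v c : v \in o -> anc (hd v) c -> anc c v -> c != hd v -> m c.
Proof.
move=> vo hc cv nch; have [co _] := anc_in vo cv.
by apply: contraNT nch => /negbTE mc; rewrite -(hd_chain vo hc cv) hdE // mc.
Qed.

Lemma anc_back s u : s \in o -> e s u -> idx u < idx s -> anc u s.
Proof.
by move=> so esu; apply: (nt_back nt) => //; [exact: (nt_closed nt so esu) | rewrite e_sym].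
Qed.

Lemma root_in v : v \in o -> x \in o.
Proof.
rewrite -(index_mem v) -(index_mem x) (nt_root nt).
exact: leq_ltn_trans.
Qed.

Lemma anc_root u : anc u x -> u = x.
Proof.
case/anc_iter => k ->; elim: k => //= k ->; exact: nt_par_root nt.
Qed.

(** The child of [hd v] towards [v] satisfies [m], and its edge ends at a proper ancestor of [hd v]
    other than [x]. A child of the root has no such ancestor. *)
Lemma block_top v : v \in o -> m v ->
  [/\ hd v \in o, hd v != x, par (hd v) != x, par (hd v) \in o
    & idx (par (hd v)) < idx (hd v)].
Proof.
move=> vo mv; have [hv mh] := hd_anc vo.
have [ho _] := anc_in vo hv.
have nhv : hd v != v by apply: contraTneq mv => <-; rewrite mh.
have [c [cv pc ncx ltc]] := anc_child vo hv nhv.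
have [co _] := anc_in vo cv.
have hc : anc (hd v) c by rewrite -pc; exact: par_anc.
have nch : c != hd v by apply: contraTneq ltc => ->; rewrite ltnn.
have [s [u [cs so esu nux ltu]]] := (mP co ncx).1 (hd_m vo hc cv nch).
rewrite pc in ltu.
have hs : anc (hd v) s by apply: connect_trans cs hc.
have [_ les] := anc_in so hs.
have us : anc u s by apply: anc_back => //; arith.
have nhx : hd v != x by apply: contraTneq ltu => ->; rewrite (nt_root nt).
have [po lt _] := nt_par nt ho nhx; split=> //.
have uh : anc u (hd v) by apply: anc_total us hs _ => //; arith.
apply: contraNneq nux => px; apply/eqP/anc_root; rewrite -px.
by apply: anc_par => //; apply: contraTneq ltu => ->; rewrite ltnn.
Qed.

(** * Blocks are 2-connected *)

Section BlockConnected.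
Variable v0 : T.
Hypotheses (v0o : v0 \in o) (mv0 : m v0).
Local Notation h := (hd v0).
Local Notation p := (par h).

Lemma in_block v : v \in block h = (v == p) || [&& v \in o, v != x & hd v == h].
Proof. by rewrite !inE. Qed.

Lemma block_climb w t v : t \in block h -> v \in block h -> anc t v ->
  (forall c, anc t c -> anc c v -> c != w) -> connect (within e (block h) w) v t.
Proof.
have [ho nhx npx po ltp] := block_top v0o mv0.
move=> tB; have [k] := ubnP (idx v); elim: k v => // k IH v ltk vB tv nw.
have [->|ntv] := eqVneq t v; first exact: connect0.
have tpv := anc_par tv ntv.
move: (vB); rewrite in_block => /orP[/eqP evp|/and3P[vo nvx /eqP hv]].
  have [to le1] : t \in o /\ idx t <= idx v by apply: anc_in; rewrite // evp.
  move: tB; rewrite in_block => /orP[/eqP etp|/and3P[_ _ /eqP ht]].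
    by rewrite evp etp eqxx in ntv.
  have [ht' _] := hd_anc to; rewrite ht in ht'.
  by have [_ le2] := anc_in to ht'; move: le1; rewrite evp; arith.
have [pvo ltv epv] := nt_par nt vo nvx.
have pvB : par v \in block h.
  rewrite in_block; have [evh|nvh] := eqVneq v h; first by rewrite evh eqxx.
  have mv : m v by apply: contraNT nvh => /negbTE mv; rewrite -hv hdE // mv.
  have hpv : hd (par v) = h by rewrite -hv [RHS]hdE // mv.
  rewrite pvo hpv eqxx andbT; apply/orP; right.
  apply: contraNneq nhx => pvx; apply/eqP.
  by rewrite -hpv pvx hdE ?m_root //; exact: root_in vo.
apply: connect_trans (IH _ _ pvB tpv _); last first.
- by move=> c tc cp; apply: nw => //; apply: connect_trans cp; exact: par_anc.
- by arith.
apply: connect1; rewrite /within /= e_sym epv vB pvB !nw //; exact: par_anc.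
Qed.

Lemma in_block_top : p \in block h.
Proof. by rewrite in_block eqxx. Qed.

(** If [w] is not above [v], climbing the tree suffices. Otherwise the child [c] of [w] towards [v]
    satisfies [m], and its edge from [s] to [u] jumps over [w]: the route is [v], [c], [s], [u],
    [p]. *)
Lemma block_to_top w v : w \in block h -> w != p -> v \in block h -> v != w ->
  connect (within e (block h) w) v p.
Proof.
have [ho nhx npx po ltp] := block_top v0o mv0.
move=> wB nwp vB nvw.
have tp u : u \in block h -> anc p u.
  rewrite in_block => /orP[/eqP->|/and3P[uo _ /eqP hu]]; first exact: connect0.
  have [hu' _] := hd_anc uo; rewrite hu in hu'.
  by apply: connect_trans hu' _; exact: par_anc.
have [awv|nawv] := boolP (fconnect par v w); last first.
  apply: block_climb (in_block_top) vB (tp v vB) _ => c _ cv.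
  by apply: contraNneq nawv => <-.
have vo : v \in o by move: vB; rewrite in_block => /orP[/eqP->|/and3P[]].
have wo : w \in o by move: wB; rewrite in_block => /orP[/eqP->|/and3P[]].
have hw : hd w = h.
  by move: wB; rewrite in_block (negPf nwp) => /and3P[_ _ /eqP].
have [hw' mh] := hd_anc wo; rewrite hw in hw' mh.
have hv : hd v = h.
  move: vB; rewrite in_block => /orP[/eqP evp|/and3P[_ _ /eqP //]].
  have [_ le1] := anc_in vo awv; have [_ le2] := anc_in wo hw'.
  by move: le1; rewrite evp; arith.
have nwv : w != v by rewrite eq_sym.
have [c [cv pc ncx ltc]] := anc_child vo awv nwv.
have [co _] := anc_in vo cv.
have wc : anc w c by rewrite -pc; exact: par_anc.
have hc : anc h c by apply: connect_trans wc hw'.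
have [_ lehw] := anc_in wo hw'.
have nch : c != h by apply: contraTneq ltc => ->; arith.
have mc : m c by apply: hd_m vo _ cv _; rewrite hv.
have hdc : hd c = h by rewrite (hd_chain vo _ cv) hv.
have [s [u [cs so esu nux ltu]]] := (mP co ncx).1 mc; rewrite pc in ltu.
have [_ lecs] := anc_in so cs.
have us : anc u s by apply: anc_back => //; arith.
have [uo _] := anc_in so us.
have hs : anc h s by apply: connect_trans cs hc.
have pre_par a : a \in o -> anc w (par a) -> a != x -> idx w <= idx (par a).
  by move=> ao wa nax; have [pao _ _] := nt_par nt ao nax; case: (anc_in pao wa).
(* Every node from [c] down to [s] satisfies [m] by the same edge from [s] to [u]. *)
have hds : hd s = h.
  apply: hd_eq => // d hd' ds ndh; have [do_ _] := anc_in so ds.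
  have [ltdc|ltcd] := leqP (idx d) (idx c).
    have dc := anc_total so ds cs ltdc.
    by apply: (hd_m co); rewrite ?hdc.
  have cd := anc_total so cs ds (ltnW ltcd).
  have ndx : d != x by apply: contraTneq ltcd => ->; rewrite (nt_root nt).
  apply/(mP do_ ndx); exists s, u; split=> //.
  apply: (leq_trans ltu); apply: pre_par => //; apply: connect_trans wc.
  by apply: anc_par => //; apply: contraTneq ltcd => ->; rewrite ltnn.
(* If [u] were above [p], this edge would put [h] itself into the block of its parent, against
   [mh]. *)
have hup : anc p u.
  have ps : anc p s by apply: connect_trans hs (par_anc _).
  apply: (anc_total so ps us); rewrite leqNgt.
  apply: contraFN mh => ltup; apply/(mP ho nhx).
  by exists s, u.
have uB : u \in block h.
  rewrite in_block uo nux; have [//|nup] := eqVneq u p.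
  have leup : idx h <= idx u.
    rewrite leqNgt; apply: contraNN nup => ltuh.
    have uh : anc u h by apply: (anc_total so us hs); arith.
    have : anc u p by apply: anc_par => //; apply: contraTneq ltuh => ->; rewrite ltnn.
    move/(anc_in po) => [_ le1]; have [_ le2] := anc_in uo hup.
    by apply/eqP; apply: idx_inj => //; arith.
  have hu : anc h u := anc_total so hs us leup.
  by rewrite -hds in hu *; rewrite (hd_chain so hu us) eqxx orbT.
have nsx : s != x by apply: contraTneq lecs => ->; rewrite (nt_root nt); arith.
have sB : s \in block h by rewrite in_block so nsx hds eqxx orbT.
have cB : c \in block h by rewrite in_block co ncx hdc eqxx orbT.
have below a : anc c a -> a \in o -> a != w.
  by move=> ca ao; have [_ le] := anc_in ao ca; apply: contraTneq le => ->; arith.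
have vc : connect (within e (block h) w) v c.
  by apply: block_climb => // d cd dv; apply: below => //; case: (anc_in vo dv).
have sc : connect (within e (block h) w) s c.
  by apply: block_climb => // d cd ds; apply: below => //; case: (anc_in so ds).
have up : connect (within e (block h) w) u p.
  apply: block_climb in_block_top uB hup _ => d _ du.
  by have [_ le] := anc_in uo du; apply: contraTneq le => ->; arith.
apply: connect_trans vc _; apply: connect_trans up.
rewrite (sym_connect_sym (within_sym e_sym _ _)).
apply: connect_trans _ sc; rewrite (sym_connect_sym (within_sym e_sym _ _)).
apply: connect1; rewrite /within /= esu sB uB below //=.
by apply: contraTneq ltu => ->; rewrite ltnn.
Qed.

(** All remaining nodes have a common meeting point: [h] if the topmost node is deleted, and [p]
    otherwise. *)
Lemma block_2connected w a b : w \in block h -> a \in block h -> b \in block h ->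
  a != w -> b != w -> connect (within e (block h) w) a b.
Proof.
have [ho nhx npx po ltp] := block_top v0o mv0.
have csym := sym_connect_sym (within_sym e_sym (block h) w).
move=> wB; suff [t top] : exists t, forall a, a \in block h -> a != w ->
    connect (within e (block h) w) a t.
  move=> aB bB naw nbw; apply: connect_trans (top a aB naw) _.
  by rewrite csym; exact: top.
have [ewp|nwp] := eqVneq w p; last by exists p => c cB ncw; exact: block_to_top.
exists h => c cB ncw.
move: (cB); rewrite in_block -ewp (negPf ncw) => /and3P[co _ /eqP hc].
have [hc' _] := hd_anc co; rewrite hc in hc'.
apply: block_climb => //.
  by rewrite in_block ho nhx -hc (hd_chain co) ?hc ?eqxx ?orbT //; exact: connect0.
move=> d hd' dc; rewrite ewp; have [do_ _] := anc_in co dc.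
by have [_ le] := anc_in do_ hd'; apply: contraTneq le => ->; arith.
Qed.

End BlockConnected.

Lemma block_common_cycle v y z : v \in o -> m v ->
  y \in block (hd v) -> z \in block (hd v) -> y != z ->
  common_cycle e (~: [set x]) y z.
Proof.
move=> vo mv yB zB nyz; have [ho nhx npx po ltp] := block_top vo mv.
have card3 : 2 < #|block (hd v)|.
  have [hv mh] := hd_anc vo.
  have nhv : hd v != v by apply: contraTneq mv => <-; rewrite mh.
  have nph : par (hd v) != hd v by apply: contraTneq ltp => ->; rewrite ltnn.
  have nvp : v != par (hd v).
    have [_ le] := anc_in vo hv.
    apply/eqP => /(congr1 (index^~ o)) E; arith.
  have <- : #|[set v; hd v; par (hd v)]| = 3.
    by rewrite -setUA cardsU1 cards2 !inE negb_or eq_sym nhv nvp eq_sym nph.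
  apply: subset_leq_card; apply/subsetP => c.
  rewrite !inE => /orP[/orP[]|] /eqP ->; rewrite ?eqxx //.
    by rewrite vo (m_neq mv) orbT.
  by rewrite ho nhx (hd_chain vo) ?eqxx ?orbT //; exact: connect0.
have [C [sC uC cC subC [yC zC]]] :=
  common_cycle_of_2connected e_sym e_irr card3 (@block_2connected v vo mv) yB zB nyz.
exists C; split=> // c /subC; rewrite !inE.
by case/orP => [/eqP->|/and3P[]].
Qed.

(** * Every cycle avoiding the root lies in one block *)

Lemma path_leave (S : pred T) a p : path e a p -> S a -> ~~ S (last a p) ->
  exists b c, [/\ S b, ~~ S c, e b c & b \in a :: p /\ c \in p].
Proof.
elim: p a => [|b p IH] a /=; first by move=> _ ->.
case/andP => eab pb Sa nS; have [Sb|nSb] := boolP (S b).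
  have [c [d [Sc nSd ecd [cp dp]]]] := IH b pb Sb nS.
  by exists c, d; split=> //; rewrite !(in_cons a, in_cons b p d) ?cp ?dp !orbT.
by exists a, b; split=> //; rewrite !inE !eqxx.
Qed.

(** Apart from its node [t] of least index, the cycle lies below one child [h] of [t], and every
    node that is strictly below [h] and above a node of the cycle satisfies [m]. Hence all these
    nodes share the head of [h]. *)
Lemma cycle_in_block C : {subset C <= o} -> x \notin C -> 2 < size C ->
  uniq C -> cycle e C ->
  exists v, [/\ v \in o, m v & {subset C <= block (hd v)}].
Proof.
move=> Co xC sC uC cC.
have [t tC tmin] : exists2 t, t \in C & forall c, c \in C -> idx t <= idx c.
  case: C sC {Co xC uC cC} => // a C _.
  have aC : a \in a :: C by rewrite inE eqxx.
  by case: (arg_minnP (fun c => idx c) aC) => t tC tmin; exists t.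
have [i r Er] := rot_to tC.
have memC : C =i t :: r by move=> c; rewrite -Er mem_rot.
have to : t \in o by exact: Co.
have {}sC : 1 < size r by move: sC; rewrite -(size_rot i) Er.
move: uC cC xC; rewrite -(rot_uniq i) -(rot_cycle i) Er memC => uC cC xC.
have ltr c : c \in r -> c \in o /\ idx t < idx c.
  move=> cr; have cC' : c \in C by rewrite memC inE cr orbT.
  have co := Co _ cC'; split=> //; rewrite ltn_neqAle tmin // andbT.
  apply: contraL uC => /eqP E; rewrite -(idx_inj to E) in cr.
  by rewrite /= cr.
(* Without [t] the cycle is a path whose consecutive nodes are comparable. Leaving the subtree of
   [h] would mean reaching an ancestor of [t], whose index is too small. *)
have [h [ph hx hr]] : exists h, [/\ par h = t, h != x & forall c, c \in r -> anc h c].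
  case: r sC {Er memC uC xC} cC ltr => // r0 r _ /= /andP[et0 pr] ltr.
  have [r0o lt0] := ltr r0 (mem_head _ _).
  have tr0 : anc t r0 by apply: (nt_back nt).
  have nt0 : t != r0 by apply: contraTneq lt0 => ->; rewrite ltnn.
  have [h [hr0 ph hx _]] := anc_child r0o tr0 nt0; exists h; split=> // c.
  move: pr; rewrite rcons_path => /andP[pr _].
  elim: r r0 r0o hr0 pr ltr {et0 lt0 tr0 nt0} => [|b r IH] a ao ha /=.
    by move=> _ _; rewrite inE => /eqP ->.
  case/andP => eab pb ltr; rewrite inE => /orP[/eqP -> //|cr].
  have [bo ltb] : b \in o /\ idx t < idx b by apply: ltr; rewrite !inE eqxx orbT.
  have hb : anc h b.
    have [ab|ba] := anc_edge ao eab; first exact: connect_trans ab ha.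
    have [le|lt] := leqP (idx h) (idx b); first exact: anc_total ao ha ba le.
    have bh : anc b h by apply: anc_total ba ha _ => //; arith.
    have bt : anc b t.
      by rewrite -ph; apply: anc_par => //; apply: contraTneq lt => ->; rewrite ltnn.
    by have [_] := anc_in to bt; arith.
  by apply: (IH b) => // d dr; apply: ltr; rewrite inE dr orbT.
(* Both arcs of the cycle from [v] to [t] leave the subtree of [c], and one of them avoids [par c].
   The edge on which that arc leaves ends at a proper ancestor of [par c]. *)
have mr v c : v \in r -> anc h c -> anc c v -> c != h -> m c.
  move=> vr hc cv nch; have [vo _] := ltr v vr; have [co _] := anc_in vo cv.
  have hq : anc h (par c) by apply: anc_par => //; rewrite eq_sym.
  have ncx : c != x.
    by apply: contraNneq nch => cx; rewrite cx in hc *; rewrite (anc_root hc).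
  have [qo ltq _] := nt_par nt co ncx.
  have nht : ~~ fconnect par t h.
    apply/negP => ht; have [ho le1] := anc_in to ht.
    by have [_ lt _] := nt_par nt ho hx; move: lt; rewrite ph; arith.
  have nct : ~~ fconnect par t c.
    by apply: contra nht => tc; apply: connect_trans tc hc.
  have [p [pp lp qp pC]] : exists p, [/\ path e v p, last v p = t, par c \notin p
      & {subset p <= t :: r}].
    have nqt : par c != t by apply: contraNneq nht => <-.
    have sub r' : {subset r' <= r} -> {subset rcons r' t <= t :: r}.
      by move=> sub d; rewrite mem_rcons !inE => /orP[->//|/sub ->]; rewrite orbT.
    move: uC cC sub; case/splitPr: vr => r1 r2 uC cC sub.
    have nq12 : ~~ ((par c \in r1) && (par c \in r2)).
      apply: contraL uC => /andP[q1 q2].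
      rewrite /= cat_uniq !negb_and !negbK; apply/orP; right; apply/orP; right.
      by apply/orP; left; apply/hasP; exists (par c); rewrite // inE q2 orbT.
    have [q2|nq2] := boolP (par c \in r2).
      rewrite q2 andbT in nq12; exists (rcons (rev r1) t).
      rewrite last_rcons mem_rcons inE mem_rev negb_or nqt nq12; split=> //.
        move: cC; rewrite -(cycle_flip e_sym) rev_cat rev_cons cat_rcons /=.
        by rewrite rcons_cat cat_path /= => /and3P[].
      by apply: sub => d; rewrite mem_rev mem_cat => ->.
    exists (rcons r2 t); rewrite last_rcons mem_rcons inE negb_or nqt nq2; split=> //.
      by move: cC; rewrite /= rcons_cat cat_path /= => /and3P[].
    by apply: sub => d dr; rewrite mem_cat inE dr !orbT.
  have ntC : ~~ fconnect par (last v p) c by rewrite lp.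
  have [a [b [ca ncb eab [ap bp]]]] := path_leave (S := fun a => fconnect par a c) pp cv ntC.
  have ao : a \in o.
    by move: ap; rewrite inE => /orP[/eqP->//|/pC]; rewrite -memC; exact: Co.
  have bC := pC _ bp; have bo : b \in o by move: bC; rewrite -memC; exact: Co.
  have nbx : b != x by apply: contraNneq xC => <-.
  have ba : anc b a.
    have [ab|//] := anc_edge ao eab.
    by rewrite (connect_trans ab ca) in ncb.
  have ltbc : idx b < idx c.
    by rewrite ltnNge; apply: contra ncb => le; exact: anc_total ao ca ba le.
  have bc : anc b c by apply: anc_total ba ca _ => //; arith.
  have bq : anc b (par c) by apply: anc_par => //; apply: contraTneq ltbc => ->; rewrite ltnn.
  apply/(mP co ncx); exists a, b; split=> //.
  have [_ leq] := anc_in qo bq; rewrite ltn_neqAle leq andbT.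
  by apply: contraNneq qp => /(idx_inj bo) <-.
have ho : h \in o.
  case: r sC hr ltr {Er memC uC cC xC mr} => // a r _ hr ltr.
  have [ao _] := ltr a (mem_head _ _).
  by have [] := anc_in ao (hr a (mem_head _ _)).
have [Hh mH] := hd_anc ho.
have hdr v : v \in r -> hd v = hd h.
  move=> vr; have [vo _] := ltr v vr; have hv := hr v vr.
  apply: hd_eq => //; first exact: connect_trans Hh.
  move=> c Hc cv ncH; have [co _] := anc_in vo cv.
  have [le|lt] := leqP (idx h) (idx c).
    have [ech|nch] := eqVneq c h; first by apply: (hd_m ho); rewrite // ech connect0.
    by apply: (mr v) => //; exact: anc_total vo hv cv le.
  by apply: (hd_m ho) => //; apply: anc_total cv hv _ => //; exact: ltnW.
have [v [vr nvh]] : exists v, v \in r /\ v != h.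
  case: r sC uC {Er memC xC cC ltr hr mr hdr} => [|a [|b r]] // _ /= /and3P[_ + _].
  rewrite inE negb_or => /andP[nab _]; have [eah|nah] := eqVneq a h.
    by exists b; rewrite !inE eqxx orbT -eah eq_sym.
  by exists a; rewrite inE eqxx.
have [vo _] := ltr v vr.
have mv : m v by apply: (mr v) => //; exact: hr.
exists v; split=> // d; rewrite memC inE (hdr v vr) => /orP[/eqP->|dr].
  (* If [m h] fails, [t] is the topmost node of the block; otherwise it has the same head as [h]. *)
  rewrite !inE (hdE ho); case: ifP => mh; last by rewrite ph eqxx.
  rewrite ph to eqxx andbT; apply/orP; right.
  by apply: contraNneq xC => <-; rewrite inE eqxx.
rewrite !inE (hdr d dr) eqxx andbT; have [do_ _] := ltr d dr.
by rewrite do_ /=; apply/orP; right; apply: contraNneq xC => <-; rewrite inE dr orbT.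
Qed.

End Blocks.
End NormalTree.

(** * Depth-first search *)

Section DFS.
Variables (T : finType) (e : rel T) (x : T).
Hypothesis e_sym : symmetric e.

(** [stk] lists pairs (node, parent), the top of the stack being its end.
    [dfs_pending] is what makes the search depth-first: as long as the edge
    from [u] to an unvisited [w] waits on the stack, everything above it was
    pushed by a descendant of [u]. *)
Record dfs_inv (o : seq T) (par : T -> T) (stk : seq (T * T)) : Prop := DfsInv {
  dfs_uniq : uniq o;
  dfs_root : index x o = 0;
  dfs_nonempty : o = [::] -> stk != [::];
  dfs_par_root : par x = x;
  dfs_par : forall v, v \in o -> v != x ->
    [/\ par v \in o, index (par v) o < index v o & e (par v) v];
  dfs_stk : forall q, q \in stk -> q = (x, x) \/ q.2 \in o /\ e q.2 q.1;
  dfs_back : forall u v, u \in o -> v \in o -> e u v ->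
    index u o < index v o -> fconnect par v u;
  dfs_pending : forall u w, u \in o -> w \notin o -> e u w ->
    exists s1 s2, stk = s1 ++ (w, u) :: s2 /\
      forall q, q \in s2 -> fconnect par q.2 u
}.

Lemma dfs_start : dfs_inv [::] id [:: (x, x)].
Proof. by split=> // q; rewrite inE => /eqP ->; left. Qed.

(** The equation [index x o = 0] also holds for the empty list, which [dfs_nonempty] excludes
    here. *)
Lemma dfs_root_in o par : dfs_inv o par [::] -> x \in o.
Proof.
move=> I; rewrite -index_mem (dfs_root I) lt0n size_eq0.
by apply/negP => /eqP /(dfs_nonempty I).
Qed.

Lemma dfs_finish o par : dfs_inv o par [::] -> normal_tree e x o par.
Proof.
move=> I; split; [exact: dfs_root I | exact: dfs_par_root I | exact: dfs_par I | |].
  move=> u v uo euv; apply/negPn/negP => vo.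
  by have [[|? ?] [s2 [//]]] := dfs_pending I uo vo euv.
exact: dfs_back I.
Qed.

(** Either the popped item is the one pushed by [u], or it lies above that one and was pushed by a
    descendant of [u]. *)
Lemma dfs_pending_top o par stk v p u : dfs_inv o par (rcons stk (v, p)) ->
  v \notin o -> u \in o -> e u v -> fconnect par p u.
Proof.
move=> I vo uo euv; have [s1 [s2 [E H]]] := dfs_pending I uo vo euv.
case/lastP: s2 E H => [|s2 q] E H.
  by move: E; rewrite cats1 => /rcons_inj[_ <-]; exact: connect0.
move: E; rewrite -rcons_cons -rcons_cat => /rcons_inj[_ Eq].
by have := H q; rewrite mem_rcons inE eqxx -Eq; apply.
Qed.

Lemma dfs_pop o par stk v p :
  dfs_inv o par (rcons stk (v, p)) -> v \in o -> dfs_inv o par stk.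
Proof.
move=> I vo; split; [exact: dfs_uniq I | exact: dfs_root I | by move=> o0; rewrite o0 in vo | exact: dfs_par_root I
  | exact: dfs_par I | | exact: dfs_back I |].
  by move=> q qs; apply: (dfs_stk I); rewrite mem_rcons inE qs orbT.
move=> u w uo wo euw; have [s1 [s2 [E H]]] := dfs_pending I uo wo euw.
case/lastP: s2 E H => [|s2 q] E H.
  by move: E; rewrite cats1 => /rcons_inj[_ evw _]; rewrite -evw vo in wo.
move: E; rewrite -rcons_cons -rcons_cat => /rcons_inj[-> _].
by exists s1, s2; split=> // q' q's; apply: H; rewrite mem_rcons inE q's orbT.
Qed.

Definition set_par (par : T -> T) (v p : T) : T -> T :=
  fun u => if u == v then p else par u.

Lemma set_par_anc (o : seq T) par v p a u :
  (forall b, b \in o -> par b \in o) -> v \notin o -> a \in o ->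
  fconnect par a u -> fconnect (set_par par v p) a u.
Proof.
move=> clo vo ao /connectP[q pq ->] {u}; elim: q a ao pq => [|b q IH] a ao /=.
  by rewrite connect0.
case/andP => /eqP <- pq; apply: connect_trans (IH _ (clo _ ao) pq).
apply: connect1; rewrite /= /set_par ifN //.
by apply: contraNneq vo => <-.
Qed.

(** Visited neighbors of [v] are ancestors of [p] by [dfs_pending_top], hence of [v]. The new items
    are pushed by [v], and any visited node that still waits for an unvisited one is an ancestor of
    [p] for the same reason, so [dfs_pending] survives. *)
Lemma dfs_visit o par stk v p (nb : seq T) :
  (forall u, (u \in nb) = e v u) ->
  dfs_inv o par (rcons stk (v, p)) -> v \notin o ->
  dfs_inv (rcons o v) (set_par par v p) (stk ++ [seq (u, v) | u <- nb]).
Proof.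
move=> nbP I vo.
have clo b : b \in o -> par b \in o.
  move=> bo; have [->|nbx] := eqVneq b x; last by case: (dfs_par I bo nbx).
  rewrite (dfs_par_root I); case: (o) (dfs_root I) bo => //= a o' E _.
  by move: E; rewrite inE eq_sym; case: eqP.
have idxo a : a \in o -> index a (rcons o v) = index a o.
  by move=> ao; rewrite -cats1 index_cat ao.
have idxv : index v (rcons o v) = size o.
  by rewrite -cats1 index_cat (negPf vo) /= eqxx addn0.
have ltidx a : a \in o -> index a o < size o by rewrite index_mem.
have neqv a : a \in o -> (a == v) = false.
  by move=> ao; apply: contraNF vo => /eqP <-.
have xo : o != [::] -> x \in o.
  case: (o) (dfs_root I) => //= a o'; rewrite inE eq_sym.
  by case: eqP.
have vp : v = x /\ p = x /\ o = [::] \/ p \in o /\ e p v /\ v != x.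
  have := dfs_stk I (q := (v, p)); rewrite mem_rcons inE eqxx => /(_ isT).
  have [evx|nvx] := eqVneq v x.
    have o0 : o = [::] by apply/eqP; apply: contraNT vo => /xo; rewrite evx.
    by case=> [[_ ->]|/= []]; [left | rewrite o0].
  by case=> [[evx]|/= []]; [rewrite evx eqxx in nvx | right].
have ancs a u : a \in o -> fconnect par a u -> fconnect (set_par par v p) a u.
  exact: set_par_anc.
have parv : set_par par v p v = p by rewrite /set_par eqxx.
have paro a : a \in o -> set_par par v p a = par a.
  by move=> ao; rewrite /set_par neqv.
have ancv a : a \in o -> e a v -> fconnect (set_par par v p) v a.
  move=> ao eav; have po : p \in o.
    by case: vp => [[_ [_ o0]]|[]] //; rewrite o0 in ao.
  apply: connect_trans (ancs _ _ po (dfs_pending_top I vo ao eav)).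
  by rewrite -{2}parv; exact: fconnect1.
split.
- by rewrite rcons_uniq vo (dfs_uniq I).
- case: vp => [[-> [_ ->]]|[po _]] /=; first by rewrite eqxx.
  by rewrite idxo ?(dfs_root I) //; apply: xo; apply: contraTneq po => ->.
- by case: (o).
- case: vp => [[<- [-> _]]|[po [_ nvx]]]; first by rewrite /set_par eqxx.
  by rewrite /set_par eq_sym (negPf nvx) (dfs_par_root I).
- move=> a; rewrite mem_rcons inE => /orP[/eqP->|ao] nax.
    case: vp => [[evx]|[po [epv _]]]; first by rewrite evx eqxx in nax.
    by rewrite parv mem_rcons inE po orbT idxv idxo // ltidx.
  have [po lt epa] := dfs_par I ao nax.
  by rewrite paro // mem_rcons inE po orbT !idxo.
- move=> q; rewrite mem_cat => /orP[qs|/mapP[u unb ->]].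
    have [|->|[qo eq]] := dfs_stk I (q := q); [|by left|].
      by rewrite mem_rcons inE qs orbT.
    by right; rewrite mem_rcons inE qo orbT.
  by right; rewrite /= mem_rcons inE eqxx -nbP.
- move=> a b; rewrite !mem_rcons !inE => /orP[/eqP->|ao] /orP[/eqP->|bo] eab.
  + by rewrite ltnn.
  + by rewrite idxv idxo // ltnNge ltnW // ltidx.
  + by move=> _; exact: ancv.
  + by rewrite !idxo // => lt; apply: ancs => //; exact: (dfs_back I).
- move=> a w; rewrite !mem_rcons !inE negb_or => /orP[/eqP->|ao] /andP[nwv wo] eaw.
    have : w \in nb by rewrite nbP.
    case/splitPr => n1 n2.
    exists (stk ++ [seq (u, v) | u <- n1]), [seq (u, v) | u <- n2].
    rewrite map_cat catA; split=> // q /mapP[u _ ->]; exact: connect0.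
  have [s1 [s2 [E H]]] := dfs_pending I ao wo eaw.
  case/lastP: s2 E H => [|s2 q] E H.
    by move: E; rewrite cats1 => /rcons_inj[_ evw _]; rewrite evw eqxx in nwv.
  move: E; rewrite -rcons_cons -rcons_cat => /rcons_inj[Es Eq].
  have po : p \in o.
    by case: vp => [[_ [_ o0]]|[]] //; rewrite o0 in ao.
  have pa : fconnect par p a by have := H q; rewrite mem_rcons inE eqxx -Eq; apply.
  exists s1, (s2 ++ [seq (u, v) | u <- nb]); rewrite Es -catA; split=> // r.
  rewrite mem_cat => /orP[rs|/mapP[u _ ->]] /=; last first.
    by apply: connect_trans (ancs _ _ po pa); rewrite -{2}parv; exact: fconnect1.
  have ra : fconnect par r.2 a by apply: H; rewrite mem_rcons inE rs orbT.
  apply: ancs ra.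
  have := dfs_stk I (q := r); rewrite mem_rcons inE Es mem_cat inE rs !orbT.
  case=> // [-> /=|[]//]; apply: xo; by apply: contraTneq ao => ->.
Qed.

End DFS.

(** * The program and its correctness *)

Notation "p ;; q" := (ASeq p q) (at level 60, right associativity).

Definition incr (r : var) : aprog := ASet r (AAdd (AR r) (ACst 1)).
Definition decr (r : var) : aprog := ASet r (ASub (AR r) (ACst 1)).

Definition load_list (r : var) : aprog :=
  ALoad VA (AAdd (ACst 2) (AR r)) ;; ALoad VE (AAdd (ACst 3) (AR r)).

Definition clear_loop : aprog :=
  AWhile (ALt (AR VI) (AR VN))
    (APut Pre (AR VI) (ACst 0) ;; APut Mk (AR VI) (ACst 0) ;; incr VI).

Definition mark_loop : aprog :=
  AWhile (ALt (AR VA) (AR VE))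
    (ALoad VU (AR VA) ;; APut Mk (AR VU) (ACst 1) ;; incr VA).

Definition dfs_init : aprog :=
  APut StkV (ACst 0) (AR VX) ;; APut StkP (ACst 0) (AR VX) ;;
  ASet VSp (ACst 1) ;; ASet VK (ACst 0).

Definition pop : aprog :=
  decr VSp ;; ASet VV (AA StkV (AR VSp)) ;; ASet VP (AA StkP (AR VSp)).

Definition visit : aprog :=
  APut Ord (AR VK) (AR VV) ;; incr VK ;; APut Pre (AR VV) (AR VK) ;;
  APut Par (AR VV) (AR VP) ;; ASet VL (AR VK) ;; load_list VV.

(** [VL] is a running minimum over visited neighbors other than the center. The parent may
    contribute its own number, which the strict test in [block_body] discounts. *)
Definition push_loop : aprog :=
  AWhile (ALt (AR VA) (AR VE))
    (ALoad VU (AR VA) ;; APut StkV (AR VSp) (AR VU) ;;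
     APut StkP (AR VSp) (AR VV) ;; incr VSp ;; incr VA ;;
     AIf (AEq (AR VU) (AR VX)) ASkip
       (AIf (AEq (AA Pre (AR VU)) (ACst 0)) ASkip
          (AIf (ALt (AA Pre (AR VU)) (AR VL))
             (ASet VL (AA Pre (AR VU))) ASkip))).

Definition dfs_loop : aprog :=
  AWhile (ALt (ACst 0) (AR VSp))
    (pop ;;
     AIf (AEq (AA Pre (AR VV)) (ACst 0))
       (visit ;; push_loop ;; APut Low (AR VV) (AR VL)) ASkip).

(** Reverse preorder meets children before parents, so one pass carries low points up the whole
    tree. *)
Definition low_loop : aprog :=
  AWhile (ALt (ACst 1) (AR VI))
    (decr VI ;; ASet VV (AA Ord (AR VI)) ;; ASet VP (AA Par (AR VV)) ;;
     AIf (ALt (AA Low (AR VV)) (AA Low (AR VP)))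
       (APut Low (AR VP) (AA Low (AR VV))) ASkip).

(** [Cnt] is tested only when [VV] joins an existing block. A newly opened block is one edge; it
    counts both ends, so that its topmost node is counted exactly once, but it contains no cycle. *)
Definition block_body : aprog :=
  ASet VV (AA Ord (AR VI)) ;; ASet VP (AA Par (AR VV)) ;;
  AIf (ALt (AA Low (AR VV)) (AA Pre (AR VP)))
    (ASet VH (AA Hd (AR VP)) ;; APut Hd (AR VV) (AR VH) ;;
     APut Cnt (AR VH) (AAdd (AA Cnt (AR VH)) (AA Mk (AR VV))) ;;
     AIf (ALt (ACst 1) (AA Cnt (AR VH))) (ASet Res (ACst 0)) ASkip)
    (APut Hd (AR VV) (AR VV) ;;
     APut Cnt (AR VV) (AAdd (AA Mk (AR VV)) (AA Mk (AR VP)))) ;;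
  incr VI.

Definition block_loop : aprog := AWhile (ALt (AR VI) (AR VK)) block_body.

Definition center_check : aprog :=
  ASet VI (ACst 0) ;; clear_loop ;; mark_loop ;; dfs_init ;; dfs_loop ;;
  ASet VI (AR VK) ;; low_loop ;; ASet VI (ACst 1) ;; block_loop.

Definition main_loop : aprog :=
  AWhile (ALt (AR VX) (AR VN))
    (load_list VX ;; AIf (ALt (AR VA) (AR VE)) center_check ASkip ;; incr VX).

Definition main : aprog :=
  (ASet Res (ACst 1) ;; ALoad VN (ACst 0) ;; ASet VX (ACst 0)) ;; main_loop.

(** Without edges only constant time is allowed, however many nodes there are. *)
Definition ram_prog : prog :=
  If (Eq (Read (Const 1)) (Const 0)) (Assign 0 (Const 1))
    (Seq (Assign 0 (Read (Add (Const 2) (Read (Const 0)))))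
       (Seq (compile main) (Assign 0 (Reg (var_code Res))))).

Section Correctness.
Variables (G : sgraph) (vs : seq G) (nb : G -> seq G).
Hypotheses (vsP : perm_eq vs (enum G))
  (nbP : forall v, perm_eq (nb v) (enum [pred u | edge v u])).
Variables (base : nat) (inp : nat -> nat) (off : G -> nat).

Local Notation n := (size vs).
Definition vid (v : G) : nat := index v vs.

Hypotheses (inp_n : inp 0 = n) (base_n : n + 2 < base).
Hypothesis inp_start : forall v, inp (2 + vid v) = off v.
Hypothesis inp_stop : forall v, inp (3 + vid v) = off v + size (nb v).
Hypothesis inp_nb : forall v j, j < size (nb v) ->
  inp (off v + j) = vid (nth v (nb v) j).
Hypothesis off_nb : forall v, off v + size (nb v) <= base.

Local Notation runs := (runs base inp).

Lemma vid_lt v : vid v < n.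
Proof. by rewrite /vid index_mem (perm_mem vsP) mem_enum. Qed.

Lemma vid_inj : injective vid.
Proof.
move=> u v E; rewrite -(nth_index u (s := vs) (x := u)).
  by rewrite -/(vid u) E nth_index // (perm_mem vsP) mem_enum.
by rewrite (perm_mem vsP) mem_enum.
Qed.

Lemma vid_eq u v : (vid u == vid v) = (u == v).
Proof. exact: inj_eq vid_inj u v. Qed.

Lemma mem_nb v u : (u \in nb v) = edge v u.
Proof. by rewrite (perm_mem (nbP v)) mem_enum. Qed.

Lemma nb_load v j : j < size (nb v) -> off v + j < base.
Proof. by move=> lt; apply: leq_trans (off_nb v); rewrite ltn_add2l. Qed.

Lemma update_vid f u a v :
  update f (vid u) a (vid v) = if v == u then a else f (vid v).
Proof. by rewrite /update vid_eq. Qed.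

(** * One round, for a fixed center *)

Section Center.
Variables (x : G) (r : nat).

(** [r] is the answer found before the round; it can change only in the last loop of the round. *)
Definition ctx (st : astate) : Prop :=
  [/\ vr st VN = n, vr st VX = vid x & vr st Res = r].

Lemma clear_runs st : ctx st -> vr st VI = 0 ->
  vr st VA = off x -> vr st VE = off x + size (nb x) ->
  runs clear_loop (2 * n).+1 (fun st' =>
    [/\ ctx st', vr st' VA = off x, vr st' VE = off x + size (nb x)
      & forall v, ar st' Pre (vid v) = 0 /\ ar st' Mk (vid v) = 0]) st.
Proof.
move=> C I0 A E.
pose J i st := [/\ ctx st, vr st VI = i, vr st VA = off x,
  vr st VE = off x + size (nb x)
  & forall j, j < i -> ar st Pre j = 0 /\ ar st Mk j = 0].
apply: (runs_loop (J := J)) => //.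
- move=> i {C I0 A E}st lti [[C1 C2 C3] Ii A E Z]; split; first by rewrite /= Ii C1.
  apply: runs_wp => //; rewrite /= Ii addn1; split=> // j; rewrite /= ltnS /update.
  case: (eqVneq j i) => [//|nji leji].
  by apply: Z; rewrite ltn_neqAle leji andbT.
- move=> {C I0 A E}st [C Ii A E Z]; have [C1 _ _] := C.
  rewrite /= Ii C1 ltnn; split=> //; split=> // v.
  exact: Z (vid_lt v).
Qed.

Lemma mark_runs st : ctx st -> vr st VA = off x -> vr st VE = off x + size (nb x) ->
  (forall v, ar st Pre (vid v) = 0 /\ ar st Mk (vid v) = 0) ->
  runs mark_loop (2 * size (nb x)).+1 (fun st' =>
    ctx st' /\ forall v, ar st' Pre (vid v) = 0 /\ ar st' Mk (vid v) = edge x v) st.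
Proof.
move=> C A E Z.
pose J j st := [/\ ctx st, vr st VA = off x + j, vr st VE = off x + size (nb x)
  & forall v, ar st Pre (vid v) = 0 /\ ar st Mk (vid v) = (v \in take j (nb x))].
apply: (runs_loop (J := J)) => //.
- move=> j {C Z A E}st ltj [C A E Z]; split; first by rewrite /= A E ltn_add2l.
  apply: runs_wp => //; rewrite /= A; split; first exact: nb_load.
  rewrite inp_nb // addn1 -addnS; split=> // v; rewrite /= update_vid.
  have [Z1 Z2] := Z v; rewrite Z1 Z2 (take_nth x ltj) mem_rcons inE.
  by case: eqP.
- move=> {C Z A E}st [C A E Z]; rewrite /= A E ltnn; split=> //; split=> // v.
  by have [-> ->] := Z v; rewrite take_size mem_nb.
- by split=> //; [rewrite addn0 | move=> v; rewrite take0; exact: Z].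
Qed.

Record dfs_st (o : seq G) (par : G -> G) (stk : seq (G * G)) (st : astate) : Prop :=
  DfsSt {
  st_ctx : ctx st;
  st_k : vr st VK = size o;
  st_sp : vr st VSp = size stk;
  st_pre : forall v, ar st Pre (vid v) = if v \in o then (index v o).+1 else 0;
  st_ord : forall i, i < size o -> ar st Ord i = vid (nth x o i);
  st_par : forall v, v \in o -> ar st Par (vid v) = vid (par v);
  st_mk : forall v, ar st Mk (vid v) = edge x v;
  st_stk : forall i, i < size stk ->
    ar st StkV i = vid (nth (x, x) stk i).1 /\ ar st StkP i = vid (nth (x, x) stk i).2
}.

(** [l] is the least preorder number among [v] and the visited members of [s] other than [x]; [s] is
    the part of the list of [v] read so far. *)
Definition low_ok (o s : seq G) (v : G) (l : nat) : Prop :=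
  [/\ l = (index v o).+1 \/
        exists u, [/\ u \in s, u \in o, u != x & l = (index u o).+1],
      l <= (index v o).+1
    & forall u, u \in s -> u \in o -> u != x -> l <= (index u o).+1].

(** A node visited later has a larger number than [v], so the minimum taken when [v] was visited
    remains correct. *)
Lemma low_ok_rcons o s v w l : v \in o -> w \notin o ->
  low_ok o s v l -> low_ok (rcons o w) s v l.
Proof.
move=> vo wo [H1 H2 H3].
have E u : u \in o -> index u (rcons o w) = index u o.
  by move=> uo; rewrite -cats1 index_cat uo.
split; rewrite ?E //.
- case: H1 => [->|[u [us uo nux ->]]]; [by left | right].
  by exists u; rewrite mem_rcons inE uo orbT E.
- move=> u us; rewrite mem_rcons inE => /orP[/eqP->|uo] nux; last by rewrite E // H3.
  rewrite -cats1 index_cat (negPf wo) /= eqxx addn0.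
  by apply: leq_trans H2 _; rewrite ltnS ltnW // index_mem.
Qed.

Definition lows (o : seq G) (st : astate) : Prop :=
  forall v, v \in o -> low_ok o (nb v) v (ar st Low (vid v)).

Lemma push_runs o par stk v st : v \in o ->
  dfs_st o par stk st -> vr st VV = vid v -> vr st VA = off v ->
  vr st VE = off v + size (nb v) -> vr st VL = (index v o).+1 ->
  (forall u, u \in o -> u != v -> low_ok o (nb u) u (ar st Low (vid u))) ->
  runs push_loop (2 * size (nb v)).+1 (fun st' =>
    [/\ dfs_st o par (stk ++ [seq (u, v) | u <- nb v]) st', vr st' VV = vid v,
      forall u, u \in o -> u != v -> low_ok o (nb u) u (ar st' Low (vid u))
      & low_ok o (nb v) v (vr st' VL)]) st.
Proof.
move=> vo D V A E L LO.
pose J j st := [/\ dfs_st o par (stk ++ [seq (u, v) | u <- take j (nb v)]) st,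
  vr st VV = vid v, vr st VA = off v + j /\ vr st VE = off v + size (nb v),
  forall u, u \in o -> u != v -> low_ok o (nb u) u (ar st Low (vid u))
  & low_ok o (take j (nb v)) v (vr st VL)].
apply: (runs_loop (J := J)) => //.
- move=> j {D V A E L LO}st ltj [D V [A E] LO L].
  split; first by rewrite /= A E ltn_add2l.
  apply: runs_wp => //; rewrite /= A; split; first exact: nb_load.
  rewrite inp_nb //; set u := nth v (nb v) j.
  have [[C1 C2 C3] Kk Sp Pr Od Pa Mk St] := D.
  have Sz : size (stk ++ [seq (u, v) | u <- take j.+1 (nb v)]) = (vr st VSp).+1.
    by rewrite Sp !size_cat !size_map !size_takel ?addnS // ltnW.
  have StE : stk ++ [seq (u, v) | u <- take j.+1 (nb v)] =
    rcons (stk ++ [seq (u, v) | u <- take j (nb v)]) (u, v).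
    by rewrite (take_nth v ltj) map_rcons rcons_cat.
  set st1 := set_var _ VA _.
  (* The branches of the nested tests differ only in [VL], so the rest of the invariant is settled
     once for all of them. *)
  have next st' : (forall y, y <> VL -> vr st' y = vr st1 y) -> ar st' = ar st1 ->
      low_ok o (take j.+1 (nb v)) v (vr st' VL) -> J j.+1 st'.
    move=> EV EA L'; split=> //.
    - split; rewrite ?EV ?EA //.
      + by split; rewrite EV.
      + by rewrite Sz /= addn1.
      + rewrite Sz StE => i; rewrite ltnS /= /update nth_rcons Sp => lei.
        case: (eqVneq i (size (stk ++ [seq (u0, v) | u0 <- take j (nb v)]))) => [->|nei].
          by rewrite ltnn V.
        by rewrite ltn_neqAle nei lei; apply: St; rewrite ltn_neqAle nei.
    - by rewrite EV.
    - by rewrite !EV // /= E -addnA addn1.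
    - by rewrite EA.
  have [L1 L2 L3] := L.
  have inT w : (w \in take j.+1 (nb v)) = (w == u) || (w \in take j (nb v)).
    by rewrite (take_nth v ltj) mem_rcons inE.
  have skip : (u \in o -> u != x -> vr st VL <= (index u o).+1) ->
      low_ok o (take j.+1 (nb v)) v (vr st VL).
    move=> H; split=> //.
      case: L1 => [->|[w [ws wo nwx ->]]]; [by left | right].
      by exists w; rewrite inT ws orbT.
    by move=> w; rewrite inT => /orP[/eqP->|ws] //; exact: L3.
  rewrite /= C2 vid_eq; case: (eqVneq u x) => [eux|nux].
    by apply: next => //; apply: skip; rewrite eux eqxx.
  rewrite Pr; have [uo|nuo] := boolP (u \in o); last first.
    by apply: next => //; apply: skip; rewrite (negPf nuo).
  rewrite [_ == 0]/=; case: ltnP => ltL; last by apply: next => //; exact: skip.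
  apply: next => //; first by case.
  split=> /=.
  - by right; exists u; rewrite inT eqxx.
  - exact: leq_trans (ltnW ltL) L2.
  - move=> w; rewrite inT => /orP[/eqP->|ws] // wo nwx.
    by apply: leq_trans (ltnW ltL) _; exact: L3.
- move=> {D V A E L LO}st [D V [A E] LO L]; rewrite /= A E ltnn; split=> //.
  by rewrite take_size in D L.
- split=> //; rewrite ?addn0 ?take0 ?cats0 //.
  by split; [left | rewrite L |].
Qed.
(** A node pays for its visit and for the items that it pushes; an item on the
    stack pays for being popped. *)
Definition potential (o : seq G) (stk : seq (G * G)) : nat :=
  \sum_(v : G | v \notin o) (1 + 2 * size (nb v)) + size stk.

Lemma potential_visit o stk v p : v \notin o ->
  potential o (rcons stk (v, p)) =
  potential (rcons o v) (stk ++ [seq (u, v) | u <- nb v]) + size (nb v) + 2.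
Proof.
move=> vo; rewrite /potential (bigD1 v) //= size_rcons size_cat size_map.
rewrite (eq_bigl (fun u => u \notin rcons o v)).
  by move: (bigop _ _ _) => S; arith.
by move=> u; rewrite mem_rcons inE negb_or andbC.
Qed.

(** The factor 4 comes from popping a visited node: three units for the body and one for the loop
    test, against a drop of the potential by one. A visit lowers it by the degree plus two, which
    pays for the pushes. *)
Lemma dfs_loop_runs o par stk st :
  dfs_inv (@edge G) x o par stk -> dfs_st o par stk st -> lows o st ->
  runs dfs_loop (4 * potential o stk).+1 (fun st' => exists o' par',
    [/\ dfs_inv (@edge G) x o' par' [::], dfs_st o' par' [::] st' & lows o' st']) st.
Proof.
move=> I D L.
pose Inv T st := exists o par stk, [/\ dfs_inv (@edge G) x o par stk,
  dfs_st o par stk st, lows o st & T = (4 * potential o stk).+1].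
apply: (runs_while (Inv := Inv)); [by [] | | | by exists o, par, stk].
- move=> {I D L o par stk st}T st [o [par [stk [I D L ->]]]] /=.
  rewrite (st_sp D); case/lastP: stk I D => // stk [v p] I D _.
  have [[C1 C2 C3] Kk Sp Pr Od Pa Mk St] := D.
  have [SV SP] : ar st StkV (size stk) = vid v /\ ar st StkP (size stk) = vid p.
    have := St (size stk); rewrite size_rcons ltnSn nth_rcons ltnn eqxx.
    by case.
  have Stk' i : i < size stk -> ar st StkV i = vid (nth (x, x) stk i).1 /\
      ar st StkP i = vid (nth (x, x) stk i).2.
    move=> lti; have := St i; rewrite size_rcons nth_rcons lti.
    by apply; exact: ltnW.
  have [vo|nvo] := boolP (v \in o).
    exists 3; apply: (runs_seq (T1 := 1) (T2 := 2)); apply: runs_wp => //=.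
    rewrite Sp size_rcons subSS subn0 SV SP.
    apply: runs_if => //=; rewrite Pr vo /=; apply: runs_wp => //=.
    exists (4 * potential o stk).+1; last by rewrite /potential size_rcons; arith.
    exists o, par, stk; split=> //; exact: dfs_pop I vo.
  have I' := dfs_visit (mem_nb v) I nvo.
  have [idxv idxo] : index v (rcons o v) = size o /\
      forall a, a \in o -> index a (rcons o v) = index a o.
    split=> [|a ao]; rewrite -cats1 index_cat ?ao //.
    by rewrite (negPf nvo) /= eqxx addn0.
  exists (1 + (1 + ((2 * size (nb v)).+1 + 1)).+1).
  apply: runs_seq; apply: runs_wp => //=.
  rewrite Sp size_rcons subSS subn0 SV SP.
  apply: runs_if => //=; rewrite Pr (negPf nvo) /=.
  apply: runs_seq; apply: runs_wp => //=.
  have ltb : 3 + vid v < base by have := vid_lt v; move: base_n; arith.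
  split; first by apply: ltn_trans ltb.
  split=> //; rewrite inp_start inp_stop.
  set st1 := set_var _ VE _.
  have D1 : dfs_st (rcons o v) (set_par par v p) stk st1.
    split=> //=.
    - by rewrite Kk size_rcons addn1.
    - move=> u; rewrite update_vid mem_rcons inE.
      case: (eqVneq u v) => [->|_]; first by rewrite idxv Kk addn1.
      by rewrite Pr; case: ifP => // uo; rewrite idxo.
    - move=> i; rewrite size_rcons ltnS Kk /update nth_rcons => lei.
      case: (eqVneq i (size o)) => [->|nei]; first by rewrite ltnn.
      by rewrite ltn_neqAle nei lei; apply: Od; rewrite ltn_neqAle nei.
    - move=> u; rewrite mem_rcons inE update_vid /set_par.
      by case: (eqVneq u v) => //= _ uo; exact: Pa.
  apply: runs_seq.
  apply: (runs_weaken (leqnn _) _ (push_runs _ D1 _ _ _ _ _)) => //=; last first.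
  + move=> u; rewrite mem_rcons inE => /orP[/eqP->|uo]; first by rewrite eqxx.
    by move=> _; apply: low_ok_rcons => //; exact: L.
  + by rewrite idxv Kk addn1.
  + by rewrite mem_rcons inE eqxx.
  move=> st2 [D2 V2 L2 Lv]; apply: runs_wp => //=.
  exists (4 * potential (rcons o v) (stk ++ [seq (u, v) | u <- nb v])).+1; last first.
    rewrite (potential_visit stk p nvo).  by move: (potential _ _) (size (nb v)) => P s; arith.
  exists (rcons o v), (set_par par v p), (stk ++ [seq (u, v) | u <- nb v]).
  split=> //; first by case: D2 => *; split.
  move=> u uo; rewrite /= V2 update_vid; case: (eqVneq u v) => [->|nuv] //.
  exact: L2.
- move=> {I D L o par stk st}T st [o [par [stk [I D L ->]]]] /=.
  rewrite (st_sp D) -leqNgt leqn0 => /nilP stk0; rewrite stk0 in I D.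
  by split=> //; exists o, par.
Qed.

(** * Low points on the finished tree *)

Section Tree.
Variables (o : seq G) (par : G -> G).
Hypotheses (uo : uniq o) (xo : x \in o).
Hypothesis nt : normal_tree (@edge G) x o par.
Local Notation idx v := (index v o).

Lemma par_in v : v \in o -> par v \in o.
Proof.
move=> vo; have [->|nvx] := eqVneq v x; last by case: (nt_par nt vo nvx).
by rewrite (nt_par_root nt).
Qed.

Lemma root_or v : v \in o -> idx v = 0 -> v = x.
Proof. by move=> vo v0; apply: (idx_inj vo); rewrite v0 (nt_root nt). Qed.

(** The witness keeps low points from being too small and passes from child to parent in an update;
    the two inequalities that follow bound them from above. *)
Definition low_attained (st : astate) : Prop := forall v, v \in o ->
  exists s, [/\ fconnect par s v, s \in o &
    ar st Low (vid v) = (idx s).+1 \/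
    exists u, [/\ u \in o, edge s u, u != x & ar st Low (vid v) = (idx u).+1]].

Definition low_le_edge (st : astate) : Prop := forall v, v \in o ->
  ar st Low (vid v) <= (idx v).+1 /\
  forall u, u \in o -> edge v u -> u != x -> ar st Low (vid v) <= (idx u).+1.

Definition low_le_child (k : nat) (st : astate) : Prop := forall c, c \in o ->
  c != x -> k <= idx c -> ar st Low (vid (par c)) <= ar st Low (vid c).

(** Handling the node of index [i] changes only the low point of its parent, of smaller index, and
    only downwards. So the inequalities already reached for indices above [i] persist. *)
Lemma low_loop_runs st : dfs_st o par [::] st -> lows o st -> vr st VI = size o ->
  runs low_loop (2 * size o).+1 (fun st' => [/\ dfs_st o par [::] st',
    low_attained st', low_le_edge st' & low_le_child 1 st']) st.
Proof.
move=> D L I.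
pose J j st := [/\ dfs_st o par [::] st, vr st VI = size o - j,
  low_attained st, low_le_edge st & low_le_child (size o - j) st].
have so : 0 < size o by rewrite lt0n size_eq0; apply: contraTneq xo => ->.
apply: (runs_weaken (T := (2 * (size o).-1).+1) _ (fun _ H => H)); first by arith.
apply: (runs_loop (J := J)) => //.
- move=> j {D L I}st ltj [D Ij LA LE LC].
  have Sj : size o - j = (size o - j.+1).+1 by arith.
  split; first by rewrite /= Ij; arith.
  apply: runs_wp => //=; rewrite Ij Sj subn1 [_.-1]/=.
  set i := size o - j.+1.
  have lti : i < size o by rewrite /i; arith.
  have i0 : 0 < i by rewrite /i; arith.
  set c := nth x o i.
  have co : c \in o by exact: mem_nth.
  have ci : idx c = i by exact: index_uniq.
  have ncx : c != x by apply: contraTneq i0 => cx; rewrite -ci cx (nt_root nt).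
  have [po ltp _] := nt_par nt co ncx.
  have [C Kk Sp Pr Od Pa Mk St] := D.
  rewrite (Od i lti) -/c (Pa c co).
  have [s [sc_ so_ Ls]] := LA c co; have [Lc Le] := LE c co.
  have npc : par c != c by apply: contraTneq ltp => ->; rewrite ltnn.
  case: ifP => [lt|nlt]; last first.
    split=> //.
    move=> d do_ ndx led; have [edc|ndc] := eqVneq d c.
      by rewrite /= edc leqNgt nlt.
    apply: LC => //; rewrite Sj ltn_neqAle led andbT.
    by apply: contraNneq ndc => E; apply/eqP/(idx_inj do_); rewrite ci -E.
  split=> //.
  - move=> v vo; rewrite /= update_vid; case: (eqVneq v (par c)) => [->|_]; last exact: LA.
    exists s; split=> //; apply: connect_trans sc_ _; exact: fconnect1.
  - move=> v vo; rewrite /= update_vid; case: (eqVneq v (par c)) => [->|_]; last exact: LE.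
    have [Lp Lpe] := LE _ po; split; first exact: leq_trans (ltnW lt) Lp.
    by move=> u uo' epu nux; apply: leq_trans (ltnW lt) _; exact: Lpe.
  - move=> d do_ ndx led; rewrite /= !update_vid.
    have -> : (d == par c) = false.
      by apply: contraTF led => /eqP ->; rewrite -ltnNge -/i -ci.
    have [edc|ndc] := eqVneq d c; first by rewrite edc eqxx.
    have ltd : i < idx d.
      rewrite ltn_neqAle led andbT.
      by apply: contraNneq ndc => E; apply/eqP/(idx_inj do_); rewrite ci -E.
    have Ld : ar st Low (vid (par d)) <= ar st Low (vid d) by apply: LC => //; rewrite Sj.
    case: (eqVneq (par d) (par c)) => // epd.
    by apply: leq_trans Ld; rewrite epd; exact: ltnW.
- move=> {D L I}st [D Ij LA LE LC]; have S1 : size o - (size o).-1 = 1 by arith.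
  by rewrite /= Ij S1; split=> //; split=> //; rewrite -S1.
- split=> //; first by rewrite subn0.
  + move=> v vo; have [L1 _ _] := L v vo; exists v; split=> //.
    case: L1 => [|[u [unb uo' nux Lu]]]; [by left | right].
    by exists u; rewrite -mem_nb.
  + move=> v vo; have [_ L2 L3] := L v vo; split=> // u uo' evu; apply: L3 => //.
    by rewrite mem_nb.
  + by move=> c co _; rewrite subn0 leqNgt index_mem co.
Qed.

(** * Counting the neighbors of the center in each block *)

Section Count.
Variable low : G -> nat.
Hypothesis low_att : forall v, v \in o ->
  exists s, [/\ fconnect par s v, s \in o & low v = (idx s).+1 \/
    exists u, [/\ u \in o, edge s u, u != x & low v = (idx u).+1]].
Hypothesis low_edge : forall v u, v \in o -> u \in o -> edge v u -> u != x ->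
  low v <= (idx u).+1.
Hypothesis low_child : forall c, c \in o -> c != x -> low (par c) <= low c.

Lemma low_gt0 v : v \in o -> 0 < low v.
Proof. by move=> vo; have [s [_ _ [->|[u [_ _ _ ->]]]]] := low_att vo. Qed.

Lemma low_desc s v : s \in o -> fconnect par s v -> low v <= low s.
Proof.
move=> so /connectP[q pq ->] {v}; elim: q s so pq => [|b q IH] s so //=.
case/andP => /eqP <- pq; apply: leq_trans (IH _ (par_in so) pq) _.
have [->|nsx] := eqVneq s x; first by rewrite (nt_par_root nt).
exact: low_child.
Qed.

Definition merged : pred G := fun v => low v < (idx (par v)).+1.

(** A low point below the number of [par v] cannot be the number of a node under [v], so it comes
    from an edge. Conversely low points grow down the tree, so an edge at [s] bounds that of [v]. *)
Lemma mergedP v : v \in o -> v != x -> (merged v <->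
  exists s u, [/\ fconnect par s v, s \in o, edge s u, u != x & idx u < idx (par v)]).
Proof.
move=> vo nvx; have [po ltp _] := nt_par nt vo nvx; split.
  rewrite /merged; have [s [vs_ so [->|[u [uo' esu nux ->]]]]] := low_att vo.
    by have [_ le] := anc_in nt so vs_; move=> lt; exfalso; arith.
  by rewrite ltnS => lt; exists s, u.
case=> s [u [sv so esu nux lt]]; have uo' := nt_closed nt so esu.
have := low_desc so sv; have := low_edge so uo' esu nux.
by rewrite /merged; arith.
Qed.

Lemma merged_root : merged x = false.
Proof.
by rewrite /merged (nt_par_root nt) (nt_root nt) ltnS leqNgt low_gt0.
Qed.

(** Recursion along parents is not structural; the index of [v] is enough fuel, as it drops at each
    step. *)
Fixpoint head_rec (k : nat) (v : G) : G :=
  if k is k'.+1 then if merged v then head_rec k' (par v) else v else v.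

Definition head (v : G) : G := head_rec (idx v) v.

Lemma head_rec_le k v : v \in o -> idx v <= k -> head_rec k v = head v.
Proof.
move=> vo; rewrite /head; have [l] := ubnP (idx v).
elim: l v k vo => // l IH v k vo ltl.
case: k => [|k] lek; first by move: lek; rewrite leqn0 => /eqP ->.
have [evx|nvx] := eqVneq v x.
  by rewrite evx (nt_root nt) /= merged_root.
have [po ltp _] := nt_par nt vo nvx.
case E: (idx v) => [|i] /=; first by rewrite E in ltp.
by case: ifP => // _; rewrite !IH //; arith.
Qed.

Lemma headE v : v \in o -> head v = if merged v then head (par v) else v.
Proof.
move=> vo; rewrite {1}/head; have [->|nvx] := eqVneq v x.
  by rewrite (nt_root nt) merged_root.
have [po ltp _] := nt_par nt vo nvx.
case E: (idx v) => [|i] /=; first by rewrite E in ltp.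
by case: ifP => // _; apply: head_rec_le => //; arith.
Qed.

Local Notation blk := (block x o par head).

Definition in_count (h : G) : pred G := fun v => [&& v != x, head v == h & edge x v].

(** The content of [Cnt] at a head [h] once the first [k] nodes of the preorder are handled; the
    second summand stands for the topmost node of the block. *)
Definition count_at (k : nat) (h : G) : nat :=
  count (in_count h) (take k o) + edge x (par h).

Definition counted (k : nat) (h : G) : seq G :=
  nseq (edge x (par h)) (par h) ++ filter (in_count h) (take k o).

Lemma size_counted k h : size (counted k h) = count_at k h.
Proof. by rewrite size_cat size_nseq size_filter addnC. Qed.

Let e_sym := @edge_sym G.
Let e_irr := @edge_irr G.

(** Any [k] will do, so the program may answer before the block is complete. *)
Lemma propeller_of_count k v : v \in o -> merged v -> 1 < count_at k (head v) ->
  propeller_at x.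
Proof.
move=> vo mv; rewrite -size_counted.
have [ho nhx npx po ltp] := block_top e_sym nt mergedP merged_root headE vo mv.
have sub y : y \in counted k (head v) -> y \in blk (head v) /\ edge x y.
  rewrite mem_cat mem_nseq mem_filter !inE => /orP[/andP[ex /eqP ->]|].
    by rewrite eqxx; case: (edge x _) ex.
  case/andP => /and3P[nyx hy xy] yt.
  by rewrite (mem_take yt) nyx hy orbT.
have uc : uniq (counted k (head v)).
  rewrite cat_uniq filter_uniq ?take_uniq // andbT; apply/andP; split.
    by case: (edge x _).
  apply/hasPn => y; rewrite mem_filter mem_nseq => /andP[/and3P[_ /eqP hy _] yt].
  apply/negP => /andP[_ /eqP eyp].
  have [hyy _] := hd_anc nt merged_root headE (mem_take yt).
  have [_ le] := anc_in nt (mem_take yt) hyy.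
  by move: le ltp; rewrite hy eyp; arith.
case E: (counted k (head v)) => [|y [|z l]] // _.
have [yB xy] : y \in blk (head v) /\ edge x y by apply: sub; rewrite E inE eqxx.
have [zB xz] : z \in blk (head v) /\ edge x z by apply: sub; rewrite E !inE eqxx orbT.
have nyz : y != z by move: uc; rewrite E /= inE negb_or -andbA => /andP[].
exists y, z; split=> //.
exact: (block_common_cycle e_sym e_irr nt mergedP merged_root headE vo mv yB zB nyz).
Qed.

(** The cycle passes through a neighbor of [x], so it stays among the visited nodes and
    [cycle_in_block] puts [y] and [z] into one block. *)
Lemma count_of_propeller : propeller_at x ->
  exists v, [/\ v \in o, merged v & 1 < count_at (size o) (head v)].
Proof.
case=> y [z [xy xz nyz [C [sC uC cC subC [yC zC]]]]].
have Co : {subset C <= o}.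
  have [i l El] := rot_to yC.
  have memC : C =i y :: l by move=> c; rewrite -El mem_rot.
  move: cC; rewrite -(rot_cycle i) El /= rcons_path => /andP[pl _].
  have yo : y \in o := nt_closed nt xo xy.
  move=> c; rewrite memC; elim: l y yo pl {El memC xy nyz yC i} => [|b l IH] y yo /=.
    by move=> _; rewrite inE => /eqP ->.
  case/andP => eyb pl; rewrite inE => /orP[/eqP-> //|]; apply: IH pl.
  exact: (nt_closed nt yo eyb).
have xC : x \notin C by apply/negP => /subC; rewrite !inE eqxx.
have [v [vo mv CB]] := cycle_in_block e_sym e_irr nt mergedP merged_root headE Co xC sC uC cC.
exists v; split=> //; rewrite -size_counted.
have sub u : u \in C -> edge x u -> u \in counted (size o) (head v).
  move=> uC' xu; rewrite mem_cat mem_nseq mem_filter take_size.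
  have := CB u uC'; rewrite !inE => /orP[/eqP eu|/and3P[uo' nux hu]].
    by rewrite -eu xu eqxx.
  by rewrite /in_count nux hu xu uo' orbT.
apply: (uniq_leq_size (s1 := [:: y; z])); first by rewrite /= inE nyz.
by move=> u; rewrite !inE => /orP[] /eqP ->; apply: sub.
Qed.

Definition static (st : astate) : Prop :=
  [/\ forall v, v \in o -> ar st Pre (vid v) = (idx v).+1,
      forall i, i < size o -> ar st Ord i = vid (nth x o i),
      forall v, v \in o -> ar st Par (vid v) = vid (par v),
      forall v, ar st Mk (vid v) = edge x v
    & forall v, ar st Low (vid v) = low v].

Definition heads (k : nat) (st : astate) : Prop :=
  forall v, v \in o -> 0 < idx v < k -> ar st Hd (vid v) = vid (head v).

Definition counts (k : nat) (st : astate) : Prop :=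
  forall h, h \in o -> 0 < idx h < k -> merged h = false ->
    ar st Cnt (vid h) = count_at k h.

(** The bound is demanded only for blocks in which some [v] is merged: a block that is still a
    single edge may already have count two. *)
Definition verdict (k : nat) (st : astate) : Prop :=
  (vr st Res = 1 /\ r = 1) /\ (forall v, v \in o -> 0 < idx v < k -> merged v ->
    count_at k (head v) <= 1) \/
  vr st Res = 0 /\ exists y : G, propeller_at y.

Lemma count_at_next i h : i < size o ->
  count_at i.+1 h = count_at i h + in_count h (nth x o i).
Proof.
move=> lti; rewrite /count_at (take_nth x lti) -cats1 count_cat /= addn0.
by rewrite addnAC.
Qed.

Lemma block_loop_runs st : static st ->
  vr st VN = n /\ vr st VX = vid x -> vr st VK = size o -> vr st VI = 1 ->
  (vr st Res = 1 /\ r = 1) \/ (vr st Res = 0 /\ exists y : G, propeller_at y) ->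
  runs block_loop (2 * size o).+1 (fun st' =>
    [/\ vr st' VN = n, vr st' VX = vid x
      & ((vr st' Res = 1 /\ r = 1) /\ ~ propeller_at x) \/
        (vr st' Res = 0 /\ exists y : G, propeller_at y)]) st.
Proof.
move=> S NX K I R0.
have so : 0 < size o by rewrite lt0n size_eq0; apply: contraTneq xo => ->.
pose J j st := [/\ static st, [/\ vr st VN = n, vr st VX = vid x,
  vr st VK = size o & vr st VI = j.+1], heads j.+1 st, counts j.+1 st & verdict j.+1 st].
apply: (runs_weaken (T := (2 * (size o).-1).+1) _ (fun _ H => H)); first by arith.
apply: (runs_loop (J := J)) => //.
- move=> j {S NX K I R0}st ltj [S [N X K I] H C R].
  set i := j.+1 in I H C R; have lti : i < size o by rewrite /i; arith.
  split; first by rewrite /= I K.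
  have [Sp So Sa Sm Sl] := S.
  set v := nth x o i.
  have vo : v \in o by exact: mem_nth.
  have vi : idx v = i by exact: index_uniq.
  have nvx : v != x by apply/eqP => E; rewrite E (nt_root nt) in vi.
  have [po ltp _] := nt_par nt vo nvx.
  have idx_lt u : u \in o -> 0 < idx u < i.+1 -> u != v -> 0 < idx u < i.
    move=> uo' /andP[-> lt] nuv; rewrite ltn_neqAle -ltnS lt andbT.
    by apply: contraNneq nuv => E; apply/eqP/(idx_inj uo'); rewrite vi E.
  have head_lt u : u \in o -> head u \in o /\ idx (head u) <= idx u.
    move=> uo'; have [hu _] := hd_anc nt merged_root headE uo'.
    exact: (anc_in nt uo' hu).
  have same h : h != head v -> count_at i.+1 h = count_at i h.
    move=> nh; rewrite count_at_next // -/v /in_count eq_sym in nh *.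
    by rewrite (negPf nh) andbF addn0.
  apply: runs_wp => //=; rewrite I (So i lti) -/v (Sa v vo) Sl (Sp _ po) -/(merged v).
  case: ifP => mv.
    (* [Hd] is not set at the root. The parent is not the root here, since the low point of [v] is
       positive and at most [idx (par v)]. *)
    have p0 : 0 < idx (par v).
      by move: mv (low_gt0 vo); rewrite /merged; arith.
    have [ho nhx npx pho lth] :=
      block_top (@edge_sym G) nt mergedP merged_root headE vo mv.
    have hE : head v = head (par v) by rewrite headE // mv.
    have [_ leh] := head_lt _ po.
    have [_ mh] := hd_anc nt merged_root headE vo.
    have ih : 0 < idx (head v) < i.
      rewrite hE in lth *; move: lth leh ltp; rewrite vi; arith.
    have Hp : ar st Hd (vid (par v)) = vid (head v).
      by rewrite H ?hE // p0 -vi.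
    have Cv : ar st Cnt (vid (head v)) + edge x v = count_at i.+1 (head v).
      by rewrite C // count_at_next // -/v /in_count nvx eqxx.
    rewrite Hp Sm update_vid eqxx Cv.
    set st1 := set_var (put _ Cnt _ _) VI _; set st2 := set_var _ VI _.
    have S1 : static st1 by [].
    have H1 : heads i.+1 st1.
      move=> u uo' ui; rewrite /= update_vid.
      case: (eqVneq u v) => [->|nuv] //; apply: H => //; exact: idx_lt.
    have C1 : counts i.+1 st1.
      move=> h ho' hi mh'; rewrite /= update_vid.
      case: (eqVneq h (head v)) => [->|nh] //; rewrite same //; apply: C => //.
      by apply: idx_lt => //; apply: contraFneq mh' => ->.
    case: ifP => [big|small].
      split=> //; first by rewrite /st2 /= addn1.
      right; split=> //; exists x.
      exact: propeller_of_count vo mv big.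
    split=> //; first by rewrite /st1 /= addn1.
    case: R => [[R1 R2]|[R1 R2]]; [left | by right].
    split=> // u uo' ui mu; have [->|nh] := eqVneq (head u) (head v).
      by rewrite leqNgt small.
    rewrite same //; apply: R2 => //; apply: idx_lt => //.
    by apply: contraNneq nh => ->.
  have hv : head v = v by rewrite headE // mv.
  have below u : u \in o -> idx u < i -> head u != v.
    move=> uo' ltu; have [_ le] := head_lt u uo'.
    by apply: contraTneq ltu => E; rewrite -leqNgt -vi -E.
  rewrite !Sm.
  (* A head never comes after its nodes in preorder, so no earlier node has head [v] and the count
     starts with the two ends of the edge. *)
  have Cv : edge x v + edge x (par v) = count_at i.+1 v.
    rewrite count_at_next // -/v /in_count nvx hv eqxx /count_at /=.
    suff -> : count (in_count v) (take i o) = 0 by rewrite addnC.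
    apply/eqP; rewrite -leqn0 leqNgt -has_count; apply/hasPn => u ut.
    have uo' := mem_take ut; have ltu : idx u < i by rewrite index_ltn.
    by rewrite /in_count /= (negPf (below u uo' ltu)) andbF.
  split=> //.
  - by rewrite addn1.
  - move=> u uo' ui; rewrite /= update_vid.
    case: (eqVneq u v) => [->|nuv]; first by rewrite hv.
    by apply: H => //; exact: idx_lt.
  - move=> h ho' hi mh'; rewrite /= update_vid.
    case: (eqVneq h v) => [->|nh]; first exact: Cv.
    by rewrite same ?hv //; apply: C => //; exact: idx_lt.
  - case: R => [[R1 R2]|[R1 R2]]; [left | by right].
    split=> // u uo' ui mu; have nuv : u != v by apply: contraTneq mu => ->; rewrite mv.
    have ui' := idx_lt u uo' ui nuv; have /andP[_ ltu] := ui'.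
    by rewrite same ?hv ?below //; apply: R2.
- move=> {S NX K I R0}st [S [N X K I] H C R].
  rewrite /= I K prednK // ltnn; split=> //; split=> //.
  rewrite prednK // in R; case: R => [[R1 R2]|[R1 R2]]; [left | by right].
  split=> // /count_of_propeller[v [vo mv big]].
  have nvx : v != x by apply: contraTneq mv => ->; rewrite merged_root.
  have v0 : 0 < idx v by rewrite lt0n; apply: contraNneq nvx => /(root_or vo) ->.
  have := R2 v vo; rewrite v0 index_mem vo => /(_ isT mv).
  by rewrite leqNgt big.
- case: NX => N X; split=> //.
  + by move=> v _; rewrite ltnS; case: (idx v).
  + by move=> v _; rewrite ltnS; case: (idx v).
  + case: R0 => [R1|R1]; [left | by right].
    by split=> // v _; rewrite ltnS; case: (idx v).
Qed.

End Count.

End Tree.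
Definition degree_sum : nat := \sum_(v : G) size (nb v).

Lemma size_vs : n = #|G|.
Proof. by rewrite (perm_size vsP) cardE. Qed.

Lemma center_check_runs st : ctx st ->
  vr st VA = off x -> vr st VE = off x + size (nb x) ->
  r = 1 \/ (r = 0 /\ exists y : G, propeller_at y) ->
  runs center_check (10 * (n + degree_sum) + 20) (fun st' =>
    [/\ vr st' VN = n, vr st' VX = vid x
      & ((vr st' Res = 1 /\ r = 1) /\ ~ propeller_at x) \/
        (vr st' Res = 0 /\ exists y : G, propeller_at y)]) st.
Proof.
move=> C A E R.
have le_deg : size (nb x) <= degree_sum by rewrite /degree_sum (bigD1 x) //= leq_addr.
have pot : potential [::] [:: (x, x)] = n + 2 * degree_sum + 1.
  rewrite /potential /degree_sum big_split /= sum1_card -big_distrr /=.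
  by rewrite size_vs; congr (_ + _ + _); apply: eq_card => v.
(* The four loops other than marking contribute 2, 4, 2 and 2 times [n]; the degree sum enters 8
   times from the search and at most twice from marking. *)
apply: (runs_weaken (T := 1 + ((2 * n).+1 + ((2 * size (nb x)).+1 + (1 +
  ((4 * potential [::] [:: (x, x)]).+1 + (1 + ((2 * n).+1 + (1 + (2 * n).+1))))))))
  _ (fun _ H => H)).
  by rewrite pot; move: le_deg; move: degree_sum (size (nb x)) => D d; arith.
apply: runs_seq; apply: runs_wp => //=; set st1 := set_var _ VI _.
apply: runs_seq; apply: (runs_weaken (leqnn _) _ (clear_runs _ _ _ _)) => //.
move=> {st C A E st1} st [C A E Z].
apply: runs_seq; apply: (runs_weaken (leqnn _) _ (mark_runs C A E Z)).
move=> {C A E Z}st [[C1 C2 C3] Z].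
apply: runs_seq; apply: runs_wp => //=; rewrite C2; set st1 := set_var _ VK _.
apply: runs_seq.
have D1 : dfs_st [::] id [:: (x, x)] st1.
  split=> //=.
  - by move=> v; case: (Z v).
  - by move=> v; case: (Z v).
  - by case.
apply: (runs_weaken (leqnn _) _ (dfs_loop_runs (dfs_start _ _) D1 _)) => //.
move=> {C1 C2 C3 Z D1 st1}st [o [par [I D L]]].
have nt := dfs_finish I; have xo := dfs_root_in I; have uo := dfs_uniq I.
have leo : size o <= n by rewrite size_vs -(card_uniqP uo) max_card.
have le2 : (2 * size o).+1 <= (2 * n).+1 by arith.
apply: runs_seq; apply: runs_wp => //=; set st1 := set_var _ VI _.
have D1 : dfs_st o par [::] st1 by case: D => *; split.
apply: runs_seq; apply: (runs_weaken le2 _ (low_loop_runs uo xo nt D1 _ _)) => //; last first.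
  by rewrite /st1 /= (st_k D).
move=> {L D D1 st1}st [D LA LE LC].
apply: runs_seq; apply: runs_wp => //=; set st1 := set_var _ VI _.
have [[C1 C2 C3] Kk Sp Pr Od Pa Mk St] := D.
apply: (runs_weaken le2 (fun _ H => H)
  (block_loop_runs (low := fun v => ar st Low (vid v)) uo xo nt _ _ _ _ _ _ _ _)) => //.
- by move=> v u vo uo' evu nux; have [_] := LE v vo; apply.
- move=> c co ncx; apply: LC => //; rewrite lt0n.
  by apply: contraNneq ncx => /(root_or nt co) ->.
- split=> // v vo; rewrite /st1 /= Pr vo //.
- by rewrite /st1 /= C3; case: R => [->|[-> H]]; [left | right].
Qed.

End Center.

(** * All rounds together *)

Lemma vid_onto i : i < n -> exists v, vid v = i.
Proof.
move=> lti; have /card_gt0P[v0 _] : 0 < #|G|.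
  by rewrite -size_vs; exact: leq_ltn_trans lti.
exists (nth v0 vs i).
by rewrite /vid index_uniq // (perm_uniq vsP) enum_uniq.
Qed.

Definition degree (i : nat) : nat := inp (3 + i) - inp (2 + i).

Lemma degree_vid v : degree (vid v) = size (nb v).
Proof. by rewrite /degree inp_stop inp_start addKn. Qed.

Lemma sum_degree (v0 : G) : \sum_(0 <= i < n) degree i = degree_sum.
Proof.
rewrite /degree_sum -big_enum -(perm_big _ vsP) (big_nth v0) /=.
apply: eq_big_nat => i /andP[_ lti]; rewrite -degree_vid.
by rewrite /vid index_uniq // (perm_uniq vsP) enum_uniq.
Qed.

Lemma main_loop_runs st (v0 : G) : vr st VN = n -> vr st VX = 0 -> vr st Res = 1 ->
  runs main_loop (n * (10 * degree_sum + 5) + (10 * n + 20) * degree_sum).+1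
    (fun st' => (vr st' Res = 1 /\ forall x : G, ~ propeller_at x) \/
       (vr st' Res = 0 /\ exists x : G, propeller_at x)) st.
Proof.
move=> N X R.
(* The part of a round proportional to the degree sum is charged to every node, the part
   proportional to [n] to the degree of the center, which is positive whenever the round takes
   place. Summed up, both give a multiple of [n] times the degree sum. *)
pose c i := 4 + 10 * degree_sum + (10 * n + 20) * degree i.
pose J i st := [/\ vr st VN = n, vr st VX = i &
  (vr st Res = 1 /\ forall x : G, vid x < i -> ~ propeller_at x) \/
  (vr st Res = 0 /\ exists x : G, propeller_at x)].
apply: (runs_weaken (T := (\sum_(0 <= i < n) (c i).+1).+1) _ (fun _ H => H)).
  rewrite ltnS (eq_bigr (fun i => 10 * degree_sum + 5 + (10 * n + 20) * degree i)).
    by rewrite big_split /= sum_nat_const_nat subn0 -big_distrr /= (sum_degree v0).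
  by move=> i _; rewrite /c; move: (_ * degree i) (_ * degree_sum) => a b; arith.
apply: (runs_for (J := J)) => //.
- move=> i {N X R}st lti [N X R]; split; first by rewrite /= N X.
  have [v vi] := vid_onto lti; rewrite -{}vi in lti X R *.
  have ltb : 3 + vid v < base by have := vid_lt v; move: base_n; arith.
  have finish_round st' : vr st' VN = n -> vr st' VX = vid v ->
      vr st' Res = 1 /\ (forall x : G, vid x <= vid v -> ~ propeller_at x) \/
      vr st' Res = 0 /\ (exists x : G, propeller_at x) ->
      runs (incr VX) 1 (J (vid v).+1) st'.
    move=> N' X' R'; apply: runs_wp => //; split=> //=.
    by rewrite X' addn1.
  have le_i y : vid y <= vid v -> y = v \/ vid y < vid v.
    by rewrite leq_eqVlt => /orP[/eqP/vid_inj|]; [left | right].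
  apply: (runs_weaken (T := 1 + (((10 * (n + degree_sum) + 20) * (0 < degree (vid v)) + 1).+1 + 1))
    _ (fun _ H => H)).
    rewrite /c; case: (degree (vid v)) => [|d] /=; rewrite ?muln0 ?muln1; first by arith.
    by rewrite [(_ + _) * _.+1]mulnS; move: (_ * d) => a; arith.
  apply: runs_seq; apply: runs_wp => //=; rewrite X inp_start inp_stop degree_vid.
  split; first by apply: ltn_trans ltb.
  split=> //; set st1 := set_var _ VE _.
  apply: runs_seq; apply: runs_if => //=.
  rewrite -{1}(addn0 (off v)) ltn_add2l; case: ltnP => deg /=.
    rewrite muln1; apply: (runs_weaken _ _ (@center_check_runs v (vr st Res) st1 _ _ _ _)).
    - by rewrite leq_addr.
    - move=> st' [N' X' R']; apply: finish_round => //.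
      case: R' => [[[R1 r1] nv]|R1]; [left | by right].
      split=> // y /le_i[->//|]; case: R => [[_]|[r0]]; first by apply.
      by rewrite r1 in r0.
    - by split; rewrite // /st1 /= X.
    - by [].
    - by [].
    - by case: R => [[-> _]|[-> H]]; [left | right].
  rewrite muln0; apply: runs_wp => //=; apply: finish_round => //.
  case: R => [[R1 R2]|R]; [left | by right].
  split=> // y /le_i[->|lty]; last exact: R2.
  case=> z [_ [vz _ _ _]]; move: deg; rewrite leqn0 size_eq0 => /eqP nb0.
  by rewrite -mem_nb nb0 in vz.
- move=> {N X R}st [N X R]; rewrite /= N X ltnn; split=> //.
  case: R => [[R1 R2]|R]; [left | by right].
  by split=> // x; apply: R2; exact: vid_lt.
- by split=> //; left.
Qed.

End Correctness.

(** * Reading the input *)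

Lemma nth_scanl_addn a s i : i <= size s ->
  nth 0 (a :: scanl addn a s) i = a + sumn (take i s).
Proof.
elim: s a i => [|b s IH] a [|i] //=; rewrite ?addn0 //.
by rewrite ltnS => /IH ->; rewrite addnA.
Qed.

Lemma sumn_take_le s i : sumn (take i s) <= sumn s.
Proof. by rewrite -{2}(cat_take_drop i s) sumn_cat leq_addr. Qed.

Lemma sumn_takeS s i : i < size s ->
  sumn (take i.+1 s) = sumn (take i s) + nth 0 s i.
Proof. by move=> lt; rewrite (take_nth 0 lt) sumn_rcons addnC. Qed.

Lemma nth_flatten_row (ss : seq (seq nat)) i j :
  i < size ss -> j < size (nth [::] ss i) ->
  nth 0 (flatten ss) (sumn (take i (shape ss)) + j) = nth 0 (nth [::] ss i) j.
Proof.
elim: ss i => // s ss IH [|i] /=.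
  by move=> _ ltj; rewrite ?take0 /= nth_cat ltj.
rewrite ltnS => lti ltj; rewrite nth_cat -addnA ltnNge leq_addr /= addKn.
exact: IH.
Qed.

Section Input.
Variables (G : sgraph) (vs : seq G) (nb : G -> seq G).
Hypotheses (vsP : perm_eq vs (enum G))
  (nbP : forall v, perm_eq (nb v) (enum [pred u | edge v u])).

Let input := [:: num_nodes G; num_edges G] ++
  (num_nodes G + 3
     :: scanl addn (num_nodes G + 3) [seq size (nb v) | v <- vs]) ++
  flatten [seq [seq index u vs | u <- nb v] | v <- vs].
Let inp := nth 0 input.
Let base := inp (2 + size vs).
Let off (v : G) := inp (2 + index v vs).
Let sizes := [seq size (nb v) | v <- vs].

Lemma num_nodes_vs : num_nodes G = size vs.
Proof. by rewrite (perm_size vsP) -cardE. Qed.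

Lemma size_sizes : size sizes = size vs.
Proof. by rewrite size_map. Qed.

Lemma shape_lists : shape [seq [seq index u vs | u <- nb v] | v <- vs] = sizes.
Proof. by rewrite /shape -map_comp; apply: eq_map => v /=; rewrite size_map. Qed.

Lemma inp_offset i : i <= size vs -> inp (2 + i) = size vs + 3 + sumn (take i sizes).
Proof.
move=> lei; rewrite /inp /input nth_cat ltnNge leq_addr /= addKn.
rewrite -cat_cons nth_cat /= size_scanl size_map ltnS lei.
by rewrite nth_scanl_addn ?size_map // num_nodes_vs.
Qed.

Lemma inp_list k : inp (size vs + 3 + k) =
  nth 0 (flatten [seq [seq index u vs | u <- nb v] | v <- vs]) k.
Proof.
rewrite /inp /input nth_cat /=; have -> : (size vs + 3 + k < 2) = false by lia.
have -> : size vs + 3 + k - 2 = (size vs).+1 + k by lia.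
rewrite -cat_cons nth_cat /= size_scanl size_map.
by rewrite ltnNge leq_addr /= addKn.
Qed.

Lemma base_gt : size vs + 2 < base.
Proof. by rewrite /base inp_offset //; lia. Qed.

Lemma index_vs v : index v vs < size vs.
Proof. by rewrite index_mem (perm_mem vsP) mem_enum. Qed.

Lemma nth_sizes v : nth 0 sizes (index v vs) = size (nb v).
Proof.
by rewrite (nth_map v) ?index_vs // nth_index // (perm_mem vsP) mem_enum.
Qed.

Lemma inp_stop_off v : inp (3 + index v vs) = off v + size (nb v).
Proof.
have -> : 3 + index v vs = 2 + (index v vs).+1 by lia.
rewrite /off !inp_offset ?index_vs //; last by rewrite ltnW // index_vs.
by rewrite sumn_takeS ?size_sizes ?index_vs // nth_sizes addnA.
Qed.

Lemma off_le_base v : off v + size (nb v) <= base.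
Proof.
have E : 3 + index v vs = 2 + (index v vs).+1 by lia.
rewrite -inp_stop_off E /base !inp_offset ?index_vs //.
by rewrite leq_add2l -size_sizes take_size sumn_take_le.
Qed.

Lemma inp_neighbor v j : j < size (nb v) ->
  inp (off v + j) = index (nth v (nb v) j) vs.
Proof.
have offE : off v = size vs + 3 + sumn (take (index v vs) sizes).
  by apply: inp_offset; rewrite ltnW // index_vs.
have row : nth [::] [seq [seq index u vs | u <- nb w] | w <- vs] (index v vs) =
    [seq index u vs | u <- nb v].
  by rewrite (nth_map v) ?index_vs // nth_index // (perm_mem vsP) mem_enum.
move=> ltj; rewrite offE -(addnA (size vs + 3)) inp_list -shape_lists.
rewrite nth_flatten_row ?row ?size_map ?index_vs //.
by rewrite (nth_map v).
Qed.

Lemma degree_sum_le : degree_sum nb <= 2 * num_edges G.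
Proof.
apply: leq_trans (card_darts G); apply: leq_sum => v _.
by rewrite (perm_size (nbP v)) cardE.
Qed.

Lemma ram_prog_correct : exists (t : nat) (s : state),
  [/\ exec ram_prog (initial_state input) t s,
      t <= (100 * unit_time) * (num_nodes G * num_edges G + 1)
    & (~ contains_propeller G /\ output s = YES)
      \/ (contains_propeller G /\ output s = NO)].
Proof.
have [m0|m0] := eqVneq (num_edges G) 0.
  do 2!eexists; split.
  - apply: ExecIfTrue; last exact: ExecAssign.
    by have: num_edges G == 0 by rewrite m0.
  - rewrite m0 muln0 add0n muln1; apply: (@leq_trans unit_time).
      by [].
    by apply: leq_pmull.
  - left; split=> // /contains_propellerP[x [y [z [xy _ _ _]]]].
    have : [set x; y] \in edge_set G by apply/imsetP; exists (x, y); rewrite ?inE.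
    by move: m0; rewrite /num_edges => /cards0_eq ->; rewrite inE.
have /card_gt0P[e] : 0 < num_edges G by rewrite lt0n.
case/imsetP => -[v0 v1] /= _ _.
pose s1 := State (update (fun=> 0) 0 base) inp.
pose st := AState (fun=> 0) (fun k i => inp (base + arr_code k + 16 * i)).
have R : rep base inp st s1.
  by split=> // r; rewrite /= /update; case: r.
have H : runs base inp main
   (1 + (size vs * (10 * degree_sum nb + 5) + (10 * size vs + 20) * degree_sum nb).+1)
   (fun st' => (vr st' Res = 1 /\ forall x : G, ~ propeller_at x) \/
       (vr st' Res = 0 /\ exists x : G, propeller_at x)) st.
  apply: runs_seq; apply: runs_wp => //=; split.
    by apply: leq_ltn_trans base_gt.
  apply: (main_loop_runs vsP nbP (off := off)) => //.
  - exact: num_nodes_vs.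
  - exact: base_gt.
  - exact: inp_stop_off.
  - exact: inp_neighbor.
  - exact: off_le_base.
  - exact: num_nodes_vs.
have [t [s2 [st2 [E l R2 V]]]] := H s1 R.
have R1 : reg s2 1 = vr st2 Res by have [_ Rr _ _] := R2; exact: Rr Res.
do 2!eexists; split.
- apply: ExecIfFalse; first exact: m0.
  apply: ExecSeq; first exact: ExecAssign.
  apply: ExecSeq; last exact: ExecAssign.
  have Eb : base = inp (2 + num_nodes G) by rewrite num_nodes_vs.
  by rewrite /s1 Eb in E; exact: E.
- have n0 : 0 < size vs by apply: leq_ltn_trans (index_vs v0).
  have {}m0 : 0 < num_edges G by rewrite lt0n.
  have D := degree_sum_le.
  rewrite num_nodes_vs; set d := degree_sum nb in l D.
  set N := size vs in n0 l *; set M := num_edges G in m0 D *.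
  (* Since there is an edge, [N] and [M] are both at most [N M]. The constant 98 is generous; the
     final 100 leaves room for the code around [main], which fits in one further unit. *)
  have bound : 1 + (N * (10 * d + 5) + (10 * N + 20) * d).+1 <= 98 * (N * M + 1).
    have Nd : N * d <= 2 * (N * M) by rewrite mulnCA leq_mul2l D orbT.
    have NM1 : N <= N * M by rewrite leq_pmulr.
    have NM2 : M <= N * M by rewrite leq_pmull.
    have -> : N * (10 * d + 5) = 10 * (N * d) + 5 * N by lia.
    have -> : (10 * N + 20) * d = 10 * (N * d) + 20 * d by lia.
    by move: (N * d) (N * M) Nd NM1 NM2 => a b; lia.
  have {}l : t <= unit_time * (98 * (N * M + 1)).
    by apply: leq_trans l _; rewrite leq_mul2l bound orbT.
  apply: (@leq_trans (unit_time + unit_time * (98 * (N * M + 1)))).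
    have u100 : 100 <= unit_time by [].
    by apply: leq_trans (leq_add u100 l); move: (t) => k /=; lia.
  rewrite -mulnS [100 * _]mulnC -mulnA leq_mul2l; apply/orP; right.
  by lia.
- rewrite /output /= R1; case: V => [[-> none]|[-> some]]; [left | right]; split=> //.
    by move=> /contains_propellerP[x /none].
  exact/contains_propellerP.
Qed.

End Input.

Theorem theorem4p8 :
  exists (P : prog) (c : nat),
    forall (G : sgraph) (input : seq nat), adjacency_lists G input ->
      exists (t : nat) (s : state),
        [/\ exec P (initial_state input) t s,
            t <= c * (num_nodes G * num_edges G + 1)
          & (~ contains_propeller G /\ output s = YES)
            \/ (contains_propeller G /\ output s = NO)].
Proof.
exists ram_prog, (100 * unit_time) => G input [vs [nb [vsP nbP ->]]].
exact: ram_prog_correct.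
Qed.
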